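(* For binary operadic quadratic data $\mathcal A,\mathcal A',\mathcal B,\mathcal B'$, the projection of graded $\mathbb S_2$-modules $$(\mathcal A_1\oplus\mathcal A_1')\otimes(\mathcal B_1\oplus\mathcal B_1')\to(\mathcal A_1\otimes\mathcal B_1)\oplus(\mathcal A_1'\otimes\mathcal B_1')$$ killing $\mathcal A_1'\otimes\mathcal B_1$ and $\mathcal A_1\otimes\mathcal B_1'$ induces a morphism of binary operadic quadratic data $$\varphi_{\mathcal A\mathcal A'\mathcal B\mathcal B'}:(\mathcal A\,\underline{\circledcirc}\,\mathcal A')\bullet(\mathcal B\,\underline{\circledcirc}\,\mathcal B')\to(\mathcal A\bullet\mathcal B)\,\underline{\circledcirc}\,(\mathcal A'\bullet\mathcal B').$$ These morphisms define on $(\mathbf{BOQD},\bullet,\underline{\circledcirc},\varphi)$ the structure of a lax $2$-monoidal category, and on $(\mathbf{BOQD},\underline{\circledcirc},\bullet,\varphi)$ the structure of a colax $2$-monoidal category.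
   Context: Work over a field $K$ of characteristic $\neq2$ with $\mathbb Z$-graded vector spaces and the Koszul sign rule. An object of $\mathbf{BOQD}$ (binary operadic quadratic data) is a pair $\mathcal A=(\mathcal A_1,R(\mathcal A))$ where $\mathcal A_1$ is a graded $\mathbb S_2$-module and $R(\mathcal A)$ is a sub-$\mathbb S_3$-module of $\mathcal T(\mathcal A_1)(3)$, the arity $3$ part of the free operad on $\mathcal A_1$ (placed in arity $2$). A morphism $\mathcal A\to\mathcal B$ is a map of $\mathbb S_2$-modules $f:\mathcal A_1\to\mathcal B_1$ such that the induced map $\mathcal T(f)$ sends $R(\mathcal A)$ into $R(\mathcal B)$. For $a,a'\in\mathcal A_1$ set $\tau_1(a,a')(x,y,z)=a(a'(x,y),z)$, $\tau_2(a,a')(x,y,z)=a(a'(y,z),x)$, $\tau_3(a,a')(x,y,z)=a(a'(z,x),y)$; then $\mathcal T(\mathcal A_1)(3)=\bigoplus_{i=1}^3\tau_i(\mathcal A_1\otimes\mathcal A_1)$. Black product: $\mathcal A\bullet\mathcal B=(\mathcal A_1\otimes\mathcal B_1,\Psi(R(\mathcal A)\otimes R(\mathcal B)))$, where $\mathcal A_1\otimes\mathcal B_1$ has the diagonal $\mathbb S_2$-action and $\Psi:\mathcal T(\mathcal A_1)(3)\otimes\mathcal T(\mathcal B_1)(3)\to\mathcal T(\mathcal A_1\otimes\mathcal B_1)(3)$ is given by $\Psi(\tau_i(a,a')\otimes\tau_j(b,b'))=\delta_{ij}(-1)^{|a'||b|}\tau_i(a\otimes b,a'\otimes b')$; its unit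 is the trivial $\mathbb S_2$-module $K$ with relation $\tau_1(1,1)+\tau_2(1,1)+\tau_3(1,1)$. Product $\underline{\circledcirc}$: let $\mathcal A_1^+$ (resp. $\mathcal A_1^-$) be the $\mathbb S_2$-invariant (resp. anti-invariant) elements. Let $\{\mathcal A_1,\mathcal B_1\}$ be the sub-$\mathbb S_3$-module of $\mathcal T(\mathcal A_1\oplus\mathcal B_1)(3)$ spanned by the elements $\tau_1(a,b)+(-1)^{|a||b|}\tau_1(b,a)$ with $(a,b)\in\mathcal A_1^+\times\mathcal B_1^+$ or $(a,b)\in\mathcal A_1^-\times\mathcal B_1^-$ homogeneous. Put $\mathcal A\,\underline{\circledcirc}\,\mathcal B=(\mathcal A_1\oplus\mathcal B_1,R(\mathcal A)\oplus\{\mathcal A_1,\mathcal B_1\}\oplus R(\mathcal B))$, with unit $(0,0)$. A lax $2$-monoidal category $(\mathbf C,\boxtimes,\otimes,\varphi)$ is a category with two monoidal structures such that $\otimes:(\mathbf C,\boxtimes)^2\to(\mathbf C,\boxtimes)$ is a lax monoidal functor, with structure maps given by an interchange law $(A\otimes A')\boxtimes(B\otimes B')\to(A\boxtimes B)\otimes(A'\boxtimes B')$. A colax $2$-monoidal category $(\mathbf C,\boxtimes,\otimes,\psi)$ is one in which $\otimes:(\mathbf C,\boxtimes)^2\to(\mathbf C,\boxtimes)$ is a colax (oplax) monoidal functor, with structure maps given by an interchange law $(A\boxtimes B)\otimes(A'\boxtimes B')\to(A\otimes A')\boxtimes(B\otimes B')$. *)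

(* Defs.v *)
From HB Require Import structures.
From mathcomp Require Import all_boot all_order all_algebra all_fingroup.
From mathcomp Require Import generic_quotient.
From mathcomp Require Import boolp classical_sets cardinality fsbigop.

Set Implicit Arguments.
Unset Strict Implicit.
Unset Printing Implicit Defensive.

Import GRing.Theory.
Local Open Scope ring_scope.

Record category := Category {
  obj :> Type;
  hom : obj -> obj -> Type;
  idm : forall X, hom X X;
  compm : forall X Y Z, hom Y Z -> hom X Y -> hom X Z;
  compA : forall X Y Z T (h : hom Z T) (g : hom Y Z) (f : hom X Y),
    compm h (compm g f) = compm (compm h g) f;
  comp1m : forall X Y (f : hom X Y), compm (idm Y) f = f;
  compm1 : forall X Y (f : hom X Y), compm f (idm X) = f
}.
Arguments hom {c} _ _.
Arguments idm {c} X.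
Arguments compm {c X Y Z} _ _.

Declare Scope cat_scope.
Delimit Scope cat_scope with cat.
Notation "g \o f" := (compm g f) : cat_scope.

Definition is_iso (C : category) (X Y : C) (f : hom X Y) : Prop :=
  exists g : hom Y X, (g \o f)%cat = idm X /\ (f \o g)%cat = idm Y.

Record functor (C D : category) := Functor {
  fobj :> C -> D;
  fmap : forall X Y : C, hom X Y -> hom (fobj X) (fobj Y);
  fmap1 : forall X : C, fmap (idm X) = idm (fobj X);
  fmapM : forall (X Y Z : C) (g : hom Y Z) (f : hom X Y),
    fmap (g \o f)%cat = (fmap g \o fmap f)%cat
}.
Arguments fmap {C D} _ {X Y} _.

Section ProdCategory.
Variables C D : category.

Definition prod_hom (X Y : C * D) : Type := (hom X.1 Y.1 * hom X.2 Y.2)%type.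

Lemma prod_compA (X Y Z T : C * D)
    (h : prod_hom Z T) (g : prod_hom Y Z) (f : prod_hom X Y) :
  (h.1 \o (g.1 \o f.1), h.2 \o (g.2 \o f.2))%cat =
  ((h.1 \o g.1) \o f.1, (h.2 \o g.2) \o f.2)%cat.
Proof. by rewrite !compA. Qed.

Lemma prod_comp1m (X Y : C * D) (f : prod_hom X Y) :
  (idm Y.1 \o f.1, idm Y.2 \o f.2)%cat = f.
Proof. by case: f => f g; rewrite !comp1m. Qed.

Lemma prod_compm1 (X Y : C * D) (f : prod_hom X Y) :
  (f.1 \o idm X.1, f.2 \o idm X.2)%cat = f.
Proof. by case: f => f g; rewrite !compm1. Qed.

Definition prod_cat : category :=
  @Category (C * D)%type prod_hom (fun X => (idm X.1, idm X.2))
    (fun X Y Z g f => (g.1 \o f.1, g.2 \o f.2)%cat)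
    prod_compA prod_comp1m prod_compm1.

End ProdCategory.

Notation bifunctor C := (functor (prod_cat C C) C).

Definition bimap (C : category) (T : bifunctor C) (X Y X' Y' : C)
    (f : hom X X') (g : hom Y Y') : hom (T (X, Y)) (T (X', Y')) :=
  @fmap _ _ T (X, Y) (X', Y') (f, g).

Record monoidal (C : category) (T : bifunctor C) (I : C) := Monoidal {
  assoc : forall X Y Z : C, hom (T (T (X, Y), Z)) (T (X, T (Y, Z)));
  lunit : forall X : C, hom (T (I, X)) X;
  runit : forall X : C, hom (T (X, I)) X;
  assoc_iso : forall X Y Z, is_iso (assoc X Y Z);
  lunit_iso : forall X, is_iso (lunit X);
  runit_iso : forall X, is_iso (runit X);
  assoc_nat : forall X Y Z X' Y' Z'
      (f : hom X X') (g : hom Y Y') (h : hom Z Z'),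
    (assoc X' Y' Z' \o bimap T (bimap T f g) h =
     bimap T f (bimap T g h) \o assoc X Y Z)%cat;
  lunit_nat : forall X Y (f : hom X Y),
    (lunit Y \o bimap T (idm I) f = f \o lunit X)%cat;
  runit_nat : forall X Y (f : hom X Y),
    (runit Y \o bimap T f (idm I) = f \o runit X)%cat;
  pentagon : forall X Y Z W : C,
    (assoc X Y (T (Z, W)) \o assoc (T (X, Y)) Z W =
     bimap T (idm X) (assoc Y Z W) \o
       (assoc X (T (Y, Z)) W \o bimap T (assoc X Y Z) (idm W)))%cat;
  triangle : forall X Y : C,
    (bimap T (idm X) (lunit Y) \o assoc X I Y = bimap T (runit X) (idm Y))%cat
}.

Section ProdMonoidal.
Variables (C : category) (T : bifunctor C) (I : C) (M : monoidal T I).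
Let C2 := prod_cat C C.

Definition prod_tensor_map (X Y : prod_cat C2 C2) (f : hom X Y) :
    @hom C2 (T (X.1.1, X.2.1), T (X.1.2, X.2.2))
            (T (Y.1.1, Y.2.1), T (Y.1.2, Y.2.2)) :=
  (bimap T f.1.1 f.2.1, bimap T f.1.2 f.2.2).

Lemma bimap1 (X Y : C) : bimap T (idm X) (idm Y) = idm (T (X, Y)).
Proof. exact: (fmap1 T (X, Y)). Qed.

Lemma bimapM (X Y X' Y' X'' Y'' : C) (f' : hom X' X'') (g' : hom Y' Y'')
    (f : hom X X') (g : hom Y Y') :
  bimap T (f' \o f)%cat (g' \o g)%cat = (bimap T f' g' \o bimap T f g)%cat.
Proof. exact: (@fmapM _ _ T (X, Y) (X', Y') (X'', Y'') (f', g') (f, g)). Qed.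

Lemma prod_tensor_map1 X : prod_tensor_map (idm X) = idm _.
Proof. by rewrite /prod_tensor_map /= !bimap1. Qed.

Lemma prod_tensor_mapM X Y Z (g : hom Y Z) (f : hom X Y) :
  prod_tensor_map (g \o f)%cat = (prod_tensor_map g \o prod_tensor_map f)%cat.
Proof. by rewrite /prod_tensor_map /= !bimapM. Qed.

Definition prod_tensor : bifunctor C2 :=
  @Functor (prod_cat C2 C2) C2
    (fun X => (T (X.1.1, X.2.1), T (X.1.2, X.2.2)))
    prod_tensor_map prod_tensor_map1 prod_tensor_mapM.

Lemma prod_iso (X Y : C2) (f : hom X Y) : is_iso f.1 -> is_iso f.2 -> is_iso f.
Proof.
case: f => f1 f2 [g1 [/= a1 b1]] [g2 [/= a2 b2]].
by exists (g1, g2) => /=; rewrite a1 a2 b1 b2.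
Qed.

Definition prod_monoidal : monoidal prod_tensor ((I, I) : C2).
Proof.
refine (@Monoidal C2 prod_tensor (I, I)
  (fun X Y Z => (assoc M X.1 Y.1 Z.1, assoc M X.2 Y.2 Z.2))
  (fun X => (lunit M X.1, lunit M X.2))
  (fun X => (runit M X.1, runit M X.2)) _ _ _ _ _ _ _ _).
- by move=> X Y Z; apply: prod_iso; apply: assoc_iso.
- by move=> X; apply: prod_iso; apply: lunit_iso.
- by move=> X; apply: prod_iso; apply: runit_iso.
- by move=> X Y Z X' Y' Z' f g h; congr pair; apply: assoc_nat.
- by move=> X Y [f g]; congr pair; apply: lunit_nat.
- by move=> X Y [f g]; congr pair; apply: runit_nat.
- by move=> X Y Z W; congr pair; apply: pentagon.
- by move=> X Y; congr pair; apply: triangle.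
Defined.

End ProdMonoidal.

Section MonoidalFunctors.
Variables (D C : category).
Variables (TD : bifunctor D) (ID : D) (MD : monoidal TD ID).
Variables (TC : bifunctor C) (IC : C) (MC : monoidal TC IC).
Variable F : functor D C.

Record is_lax_monoidal
    (mu : forall X Y : D, hom (TC (F X, F Y)) (F (TD (X, Y))))
    (eps : hom IC (F ID)) : Prop := IsLaxMonoidal {
  lax_nat : forall X Y X' Y' (f : hom X X') (g : hom Y Y'),
    (mu X' Y' \o bimap TC (fmap F f) (fmap F g) =
     fmap F (bimap TD f g) \o mu X Y)%cat;
  lax_assoc : forall X Y Z,
    (fmap F (assoc MD X Y Z) \o
       (mu (TD (X, Y)) Z \o bimap TC (mu X Y) (idm (F Z))) =
     mu X (TD (Y, Z)) \o
       (bimap TC (idm (F X)) (mu Y Z) \o assoc MC (F X) (F Y) (F Z)))%cat;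
  lax_lunit : forall X,
    (fmap F (lunit MD X) \o (mu ID X \o bimap TC eps (idm (F X))) =
     lunit MC (F X))%cat;
  lax_runit : forall X,
    (fmap F (runit MD X) \o (mu X ID \o bimap TC (idm (F X)) eps) =
     runit MC (F X))%cat
}.

Record is_colax_monoidal
    (delta : forall X Y : D, hom (F (TD (X, Y))) (TC (F X, F Y)))
    (eta : hom (F ID) IC) : Prop := IsColaxMonoidal {
  colax_nat : forall X Y X' Y' (f : hom X X') (g : hom Y Y'),
    (delta X' Y' \o fmap F (bimap TD f g) =
     bimap TC (fmap F f) (fmap F g) \o delta X Y)%cat;
  colax_assoc : forall X Y Z,
    (assoc MC (F X) (F Y) (F Z) \o
       (bimap TC (delta X Y) (idm (F Z)) \o delta (TD (X, Y)) Z) =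
     bimap TC (idm (F X)) (delta Y Z) \o
       (delta X (TD (Y, Z)) \o fmap F (assoc MD X Y Z)))%cat;
  colax_lunit : forall X,
    (lunit MC (F X) \o (bimap TC eta (idm (F X)) \o delta ID X) =
     fmap F (lunit MD X))%cat;
  colax_runit : forall X,
    (runit MC (F X) \o (bimap TC (idm (F X)) eta \o delta X ID) =
     fmap F (runit MD X))%cat
}.

End MonoidalFunctors.

(* [box] is the monoidal structure for which the tensor product S of the second
   monoidal structure [ten] is a (co)lax monoidal functor. *)
Definition lax_2monoidal (C : category)
    (T : bifunctor C) (I : C) (box : monoidal T I)
    (S : bifunctor C) (J : C) (ten : monoidal S J)
    (phi : forall A A' B B' : C,
       hom (T (S (A, A'), S (B, B'))) (S (T (A, B), T (A', B')))) : Prop :=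
  exists eps : hom I (S (I, I)),
    is_lax_monoidal (prod_monoidal box) box (F := S)
      (fun X Y =>
         let: (A, A') as X' := X
           return hom (T (S X', S Y)) (S (prod_tensor T (X', Y))) in
         let: (B, B') as Y' := Y
           return hom (T (S (A, A'), S Y')) (S (prod_tensor T ((A, A'), Y'))) in
         phi A A' B B') eps.

Definition colax_2monoidal (C : category)
    (T : bifunctor C) (I : C) (box : monoidal T I)
    (S : bifunctor C) (J : C) (ten : monoidal S J)
    (psi : forall A B A' B' : C,
       hom (S (T (A, B), T (A', B'))) (T (S (A, A'), S (B, B')))) : Prop :=
  exists eta : hom (S (I, I)) I,
    is_colax_monoidal (prod_monoidal box) box (F := S)
      (fun X Y =>
         let: (A, A') as X' := X
           return hom (S (prod_tensor T (X', Y))) (T (S X', S Y)) in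
         let: (B, B') as Y' := Y
           return hom (S (prod_tensor T ((A, A'), Y'))) (T (S (A, A'), S Y')) in
         psi A B A' B') eta.

Section Linear.
Variables (K : fieldType) (U V W : lmodType K).

Definition mk_linear (f : U -> V) (fL : linear f) : {linear U -> V} :=
  HB.pack f (GRing.isLinear.Build K U V *:%R f fL).

Inductive span (G : set U) : set U :=
  | span0 : span G 0
  | spanD c x y : G x -> span G y -> span G (c *: x + y).

Definition bilinear_map (f : U -> V -> W) : Prop :=
  (forall v, linear (f^~ v)) /\ (forall u, linear (f u)).

End Linear.

(* U (x) V is the quotient of the formal sums of pairs by the relation
   identifying two sums that have the same value under every bilinear map;
   [tens_liftE] and [tens_lift_uniq] give its universal property. *)
Section Tensor.
Variables (K : fieldType) (U V : lmodType K).

Definition eval_sum (W : lmodType K) (f : U -> V -> W) (s : seq (U * V)) : W :=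
  \sum_(p <- s) f p.1 p.2.

Definition tens_eq (s t : seq (U * V)) : bool :=
  `[< forall (W : lmodType K) (f : U -> V -> W),
        bilinear_map f -> eval_sum f s = eval_sum f t >].

Lemma tens_eq_refl : reflexive tens_eq.
Proof. by move=> s; apply/asboolP. Qed.

Lemma tens_eq_sym : symmetric tens_eq.
Proof. by move=> s t; apply/asboolP/asboolP => h W f fB; rewrite h. Qed.

Lemma tens_eq_trans : transitive tens_eq.
Proof.
by move=> t s r /asboolP h /asboolP h'; apply/asboolP => W f fB; rewrite h ?h'.
Qed.

Canonical tens_equiv := EquivRel tens_eq tens_eq_refl tens_eq_sym tens_eq_trans.

Definition tensor := {eq_quot tens_equiv}%qT.
HB.instance Definition _ := Choice.on tensor.

Definition tclass (s : seq (U * V)) : tensor := \pi_({eq_quot tens_equiv}%qT)%qT s.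
Definition trepr (x : tensor) : seq (U * V) := repr (x : {eq_quot tens_equiv}%qT).

Lemma treprK : cancel trepr tclass.
Proof. by move=> x; rewrite /tclass /trepr reprK. Qed.

Lemma tclassE s t : tclass s = tclass t <->
  forall (W : lmodType K) (f : U -> V -> W),
    bilinear_map f -> eval_sum f s = eval_sum f t.
Proof.
rewrite /tclass; split => [/eqmodP/asboolP //|h].
by apply/eqmodP/asboolP.
Qed.

Lemma trepr_eval (W : lmodType K) (f : U -> V -> W) s :
  bilinear_map f -> eval_sum f (trepr (tclass s)) = eval_sum f s.
Proof. by move: W f; apply/tclassE; rewrite treprK. Qed.

Definition tens_add (x y : tensor) : tensor := tclass (trepr x ++ trepr y).
Definition tens_scale (c : K) (x : tensor) : tensor :=
  tclass [seq (c *: p.1, p.2) | p <- trepr x].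
Definition tens_opp (x : tensor) : tensor := tens_scale (-1) x.

Lemma eval_cat (W : lmodType K) (f : U -> V -> W) s t :
  eval_sum f (s ++ t) = eval_sum f s + eval_sum f t.
Proof. exact: big_cat. Qed.

Lemma bilinZl (W : lmodType K) (f : U -> V -> W) c u v :
  bilinear_map f -> f (c *: u) v = c *: f u v.
Proof.
case=> fl _; have := fl v c u 0; rewrite addr0 => ->.
suff -> : f 0 v = 0 by rewrite addr0.
by have := fl v (-1) 0 0; rewrite scaler0 addr0 scaleN1r addNr.
Qed.

Lemma bilinZr (W : lmodType K) (f : U -> V -> W) c u v :
  bilinear_map f -> f u (c *: v) = c *: f u v.
Proof.
case=> _ fr; have := fr u c v 0; rewrite addr0 => ->.
suff -> : f u 0 = 0 by rewrite addr0.
by have := fr u (-1) 0 0; rewrite scaler0 addr0 scaleN1r addNr.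
Qed.

Lemma bilinDl (W : lmodType K) (f : U -> V -> W) u u' v :
  bilinear_map f -> f (u + u') v = f u v + f u' v.
Proof. by case=> fl _; have := fl v 1 u u'; rewrite !scale1r. Qed.

Lemma bilinDr (W : lmodType K) (f : U -> V -> W) u v v' :
  bilinear_map f -> f u (v + v') = f u v + f u v'.
Proof. by case=> _ fr; have := fr u 1 v v'; rewrite !scale1r. Qed.

Lemma eval_scale (W : lmodType K) (f : U -> V -> W) c s : bilinear_map f ->
  eval_sum f [seq (c *: p.1, p.2) | p <- s] = c *: eval_sum f s.
Proof.
move=> fB; rewrite /eval_sum big_map scaler_sumr.
by apply: eq_bigr => p _ /=; rewrite bilinZl.
Qed.

Ltac tens_eval :=
  apply/tclassE => W f fB;
  rewrite ?(eval_cat, trepr_eval, eval_scale) //.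

Lemma tens_addA : associative tens_add.
Proof. by move=> x y z; tens_eval; rewrite addrA. Qed.

Lemma tens_addC : commutative tens_add.
Proof. by move=> x y; tens_eval; rewrite addrC. Qed.

Lemma tens_add0 : left_id (tclass [::]) tens_add.
Proof.
by move=> x; rewrite -[RHS]treprK; tens_eval; rewrite /eval_sum big_nil add0r.
Qed.

Lemma tens_addN : left_inverse (tclass [::]) tens_opp tens_add.
Proof.
by move=> x; tens_eval; rewrite scaleN1r addNr /eval_sum big_nil.
Qed.

HB.instance Definition _ :=
  GRing.isZmodule.Build tensor tens_addA tens_addC tens_add0 tens_addN.

Lemma tens_scaleA a b x :
  tens_scale a (tens_scale b x) = tens_scale (a * b) x.
Proof. by tens_eval; rewrite scalerA. Qed.

Lemma tens_scale1 : left_id 1 tens_scale.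
Proof. by move=> x; rewrite -[RHS]treprK; tens_eval; rewrite scale1r. Qed.

Lemma tens_scaleDr : right_distributive tens_scale +%R.
Proof. by move=> a x y; tens_eval; rewrite scalerDr. Qed.

Lemma tens_scaleDl x : {morph tens_scale^~ x : a b / a + b}.
Proof. by move=> a b; tens_eval; rewrite scalerDl. Qed.

HB.instance Definition _ := GRing.Zmodule_isLmodule.Build K tensor
  tens_scaleA tens_scale1 tens_scaleDr tens_scaleDl.

Definition tens (u : U) (v : V) : tensor := tclass [:: (u, v)].

Lemma tens_bilinear : bilinear_map tens.
Proof.
have e1 (W : lmodType K) (f : U -> V -> W) u v : eval_sum f [:: (u, v)] = f u v.
  by rewrite /eval_sum big_seq1.
split=> [v c u u' | u c v v']; tens_eval; rewrite !e1.
  by rewrite bilinDl // bilinZl.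
by rewrite bilinDr // bilinZr.
Qed.

Definition tens_lift (W : lmodType K) (f : U -> V -> W) (x : tensor) : W :=
  eval_sum f (trepr x).

Lemma tens_lift_linear (W : lmodType K) (f : U -> V -> W) :
  bilinear_map f -> linear (tens_lift f).
Proof.
move=> fB c x y; rewrite /tens_lift.
by rewrite !(trepr_eval, eval_cat, eval_scale).
Qed.

Lemma tens_liftE (W : lmodType K) (f : U -> V -> W) u v :
  bilinear_map f -> tens_lift f (tens u v) = f u v.
Proof. by move=> fB; rewrite /tens_lift trepr_eval // /eval_sum big_seq1. Qed.

Lemma tens_ind (P : tensor -> Prop) :
  P 0 -> (forall x y, P x -> P y -> P (x + y)) ->
  (forall u v, P (tens u v)) -> forall x, P x.
Proof.
move=> P0 PD Pt x; rewrite -[x]treprK.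
elim: (trepr x) => [//|[u v] s IHs].
suff -> : tclass ((u, v) :: s) = tens u v + tclass s by apply: PD.
by tens_eval; rewrite /eval_sum big_cons big_seq1.
Qed.

Lemma tens_lift_uniq (W : lmodType K) (f g : {linear tensor -> W}) :
  (forall u v, f (tens u v) = g (tens u v)) -> f =1 g.
Proof.
move=> fg; elim/tens_ind => [|x y hx hy|//]; first by rewrite !linear0.
by rewrite !linearD hx hy.
Qed.

End Tensor.

Notation "u ⊗ v" := (tens u v) (at level 40, left associativity) : ring_scope.

Section TensorZero.
Variables (K : fieldType) (U U' : lmodType K).

Lemma tens0l (u : U') : (0 : U) ⊗ u = 0.
Proof.
by rewrite -[0 : U](scale0r 0) (bilinZl _ _ _ (@tens_bilinear K _ _)) scale0r.
Qed.

Lemma tens0r (u : U) : u ⊗ (0 : U') = 0.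
Proof.
by rewrite -[0 : U'](scale0r 0) (bilinZr _ _ _ (@tens_bilinear K _ _)) scale0r.
Qed.

End TensorZero.

Section TensorMap.
Variables (K : fieldType) (U V U' V' : lmodType K).
Variables (f : {linear U -> U'}) (g : {linear V -> V'}).

Definition tens_map (x : tensor U V) : tensor U' V' :=
  tens_lift (fun u v => f u ⊗ g v) x.

Lemma tens_map_bilinear : bilinear_map (fun u v => f u ⊗ g v).
Proof.
have tB := @tens_bilinear K U' V'.
split=> [v c u u' | u c v v']; rewrite linearP.
  by rewrite (bilinDl _ _ _ tB) (bilinZl _ _ _ tB).
by rewrite (bilinDr _ _ _ tB) (bilinZr _ _ _ tB).
Qed.

HB.instance Definition _ := GRing.isLinear.Build K (tensor U V) (tensor U' V')
  *:%R tens_map (tens_lift_linear tens_map_bilinear).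

Lemma tens_mapE u v : tens_map (u ⊗ v) = f u ⊗ g v.
Proof. by rewrite /tens_map tens_liftE //; apply: tens_map_bilinear. Qed.

Lemma tens_map0 : tens_map 0 = 0.
Proof. exact: linear0. Qed.

Lemma tens_mapD x y : tens_map (x + y) = tens_map x + tens_map y.
Proof. exact: linearD. Qed.

Lemma tens_mapZ c x : tens_map (c *: x) = c *: tens_map x.
Proof. exact: linearZ. Qed.

End TensorMap.

(* Z-graded S_2-modules: [gproj n] is the projection onto the component of
   degree n, and the generator of S_2 acts by [swap]. *)
Record s2mod (K : fieldType) := S2mod {
  carrier :> lmodType K;
  gproj : int -> {linear carrier -> carrier};
  gproj_orth : forall m n v,
    gproj m (gproj n v) = if m == n then gproj n v else 0;
  gproj_sum : forall v,
    exists2 s : seq int, uniq s & v = \sum_(n <- s) gproj n v;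
  swap : {linear carrier -> carrier};
  swapK : involutive swap;
  swap_gproj : forall n v, swap (gproj n v) = gproj n (swap v)
}.
Arguments gproj {K s} n.
Arguments swap {K s}.

Definition homogeneous (K : fieldType) (V : s2mod K) (n : int) (v : V) : Prop :=
  gproj n v = v.

Definition finsupp (K : fieldType) (U : lmodType K) (F : int -> U) : Prop :=
  exists s : seq int, forall p, p \notin s -> F p = 0.

Lemma finsupp_seq (K : fieldType) (U V : lmodType K) (F : int -> U) (G : int -> V) :
  finsupp F -> finsupp G -> exists s : seq int,
  [/\ uniq s, forall p, p \notin s -> F p = 0 & forall p, p \notin s -> G p = 0].
Proof.
move=> [s hs] [t ht]; exists (undup (s ++ t)); split; first exact: undup_uniq.
- by move=> p; rewrite mem_undup mem_cat negb_or => /andP[/hs].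
- by move=> p; rewrite mem_undup mem_cat negb_or => /andP[_ /ht].
Qed.

Section FiniteSupportSums.
Variables (K : fieldType) (U : lmodType K).
Implicit Types F G : int -> U.

Lemma fsumE F s : uniq s -> (forall p, p \notin s -> F p = 0) ->
  \sum_(p \in [set: int]) F p = \sum_(p <- s) F p.
Proof.
move=> us F0; rewrite fsbig_supp; apply: fsbig_fwiden => //.
  move=> p [_ /= Fp]; apply: contraT => ps.
  by case: Fp; apply: F0.
by move=> p [/= ps Fp]; apply: contrapT => Fp0; apply: Fp.
Qed.

Lemma fsum_linear F G c : finsupp F -> finsupp G ->
  \sum_(p \in [set: int]) (c *: F p + G p) =
  c *: (\sum_(p \in [set: int]) F p) + \sum_(p \in [set: int]) G p.
Proof.
move=> hF hG; have [s [us F0 G0]] := finsupp_seq hF hG.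
rewrite (fsumE us F0) (fsumE us G0) (fsumE us); last first.
  by move=> p ps; rewrite F0 // G0 // scaler0 addr0.
by rewrite big_split /= scaler_sumr.
Qed.

Lemma fsum1 F n : (forall p, p != n -> F p = 0) ->
  \sum_(p \in [set: int]) F p = F n.
Proof.
move=> F0; rewrite (@fsumE _ [:: n]) ?big_seq1 // => p.
by rewrite inE => /F0.
Qed.

End FiniteSupportSums.

Section S2modTheory.
Variables (K : fieldType) (V : s2mod K).

Lemma gproj_supp (v : V) : exists s : seq int,
  [/\ uniq s, v = \sum_(n <- s) gproj n v & forall p, p \notin s -> gproj p v = 0].
Proof.
have [s us vE] := gproj_sum v; exists s; split=> // p ps.
rewrite vE linear_sum big_seq big1 // => n ns.
by rewrite gproj_orth; case: eqP ps => // ->; rewrite ns.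
Qed.

Lemma gproj_finsupp (v : V) : finsupp (fun p => gproj p v).
Proof. by have [s [_ _ s0]] := gproj_supp v; exists s. Qed.

Lemma gprojE (v : V) s : uniq s -> (forall p, p \notin s -> gproj p v = 0) ->
  v = \sum_(n <- s) gproj n v.
Proof.
move=> us s0; have [t [ut vE t0]] := gproj_supp v.
by rewrite -(fsumE us s0) (fsumE ut t0).
Qed.

Lemma homog_gproj n (v : V) : homogeneous n (gproj n v).
Proof. by rewrite /homogeneous gproj_orth eqxx. Qed.

Lemma gproj_homog m n (v : V) :
  homogeneous n v -> gproj m v = if m == n then v else 0.
Proof. by move=> vn; rewrite -{1}vn gproj_orth vn. Qed.

Lemma homog_swap n (v : V) : homogeneous n v -> homogeneous n (swap v).
Proof. by rewrite /homogeneous -swap_gproj => ->. Qed.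

End S2modTheory.

Section GradedTensor.
Variables (K : fieldType) (V W : s2mod K).

Definition tens_gproj (n : int) (x : tensor V W) : tensor V W :=
  tens_lift (fun v w =>
    \sum_(p \in [set: int]) (gproj p v ⊗ gproj (n - p) w)) x.

Let tB := @tens_bilinear K V W.

Lemma tens_gproj_bilinear n : bilinear_map (fun (v : V) (w : W) =>
  \sum_(p \in [set: int]) (gproj p v ⊗ gproj (n - p) w)).
Proof.
have fin (v : V) (w : W) : finsupp (fun p => gproj p v ⊗ gproj (n - p) w).
  have [s hs] := gproj_finsupp v; exists s => p /hs ->.
  by rewrite tens0l.
split=> [w c v v' | v c w w']; rewrite -fsum_linear //;
  apply: eq_fsbigr => p _; rewrite linearP.
  by rewrite (bilinDl _ _ _ tB) (bilinZl _ _ _ tB).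
by rewrite (bilinDr _ _ _ tB) (bilinZr _ _ _ tB).
Qed.

Lemma tens_gproj_linear n : linear (tens_gproj n).
Proof. exact/tens_lift_linear/tens_gproj_bilinear. Qed.

Definition tens_gprojL n := mk_linear (tens_gproj_linear n).

Lemma tens_gproj0 n : tens_gproj n 0 = 0.
Proof. exact: (linear0 (tens_gprojL n)). Qed.

Lemma tens_gprojD n x y : tens_gproj n (x + y) = tens_gproj n x + tens_gproj n y.
Proof. exact: (linearD (tens_gprojL n)). Qed.

Lemma tens_gprojZ n c x : tens_gproj n (c *: x) = c *: tens_gproj n x.
Proof. exact: (linearZ_LR (tens_gprojL n)). Qed.

Lemma tens_gprojE m n p (v : V) (w : W) : homogeneous n v -> homogeneous p w ->
  tens_gproj m (v ⊗ w) = if m == n + p then v ⊗ w else 0.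
Proof.
move=> vn wp; rewrite /tens_gproj tens_liftE; last exact: tens_gproj_bilinear.
rewrite (@fsum1 _ _ _ n) => [|q qn]; last first.
  by rewrite (gproj_homog _ vn) (negbTE qn) tens0l.
rewrite vn (gproj_homog _ wp) subr_eq (addrC p n).
by case: eqP => // _; rewrite tens0r.
Qed.

Lemma tens_homog_ind (P : tensor V W -> Prop) :
  P 0 -> (forall x y, P x -> P y -> P (x + y)) ->
  (forall n p v w, homogeneous n v -> homogeneous p w -> P (v ⊗ w)) ->
  forall x, P x.
Proof.
move=> P0 PD Pt; elim/tens_ind => // v w.
have [s _ ->] := gproj_sum v; have [t _ ->] := gproj_sum w.
elim: s => [|n s IHs]; first by rewrite big_nil tens0l.
rewrite big_cons (bilinDl _ _ _ tB); apply/PD => //.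
elim: t {IHs} => [|p t IHt]; first by rewrite big_nil tens0r.
rewrite big_cons (bilinDr _ _ _ tB); apply/PD => //.
by apply: Pt; apply: homog_gproj.
Qed.

Lemma tens_gproj_orth m n (x : tensor V W) :
  tens_gprojL m (tens_gprojL n x) = if m == n then tens_gprojL n x else 0.
Proof.
elim/tens_homog_ind: x => [|x y hx hy|p q v w vp wq].
- by rewrite !linear0; case: ifP.
- by rewrite !linearD hx hy; case: ifP; rewrite ?addr0.
rewrite /= (tens_gprojE n vp wq); case: (n =P p + q) => [->|_].
  by rewrite (tens_gprojE m vp wq).
by rewrite tens_gproj0; case: ifP.
Qed.

Lemma tens_gproj_sum (x : tensor V W) :
  exists2 s : seq int, uniq s & x = \sum_(n <- s) tens_gprojL n x.
Proof.
suff [fs e] : finsupp (fun n => tens_gprojL n x) /\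
   x = \sum_(n \in [set: int]) tens_gprojL n x.
  have [s [us h _]] := finsupp_seq fs fs.
  by exists s => //; rewrite {1}e (fsumE us h).
elim/tens_homog_ind: x => [|x y [fx ex] [fy ey]|p q v w vp wq].
- have h n : tens_gprojL n 0 = 0 by rewrite linear0.
  by split; [exists [::] | rewrite (@fsum1 _ _ _ 0) ?h].
- split.
    have [s [_ h h']] := finsupp_seq fx fy.
    by exists s => n ns; rewrite linearD h // h' // addr0.
  rewrite {1}ex {1}ey -[X in X + _]scale1r -fsum_linear //.
  by apply: eq_fsbigr => n _; rewrite scale1r linearD.
have h n : n != p + q -> tens_gprojL n (v ⊗ w) = 0.
  by rewrite /= (tens_gprojE n vp wq) => /negbTE ->.
split; first by exists [:: p + q] => n; rewrite inE => /h.
by rewrite (fsum1 h) /= (tens_gprojE _ vp wq) eqxx.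
Qed.

Definition tens_swapL : {linear tensor V W -> tensor V W} :=
  tens_map (@swap K V) (@swap K W).

Lemma tens_swapK : involutive tens_swapL.
Proof.
elim/tens_ind => [|x y hx hy|v w]; first by rewrite !linear0.
  by rewrite !linearD hx hy.
by rewrite /= !tens_mapE !swapK.
Qed.

Lemma tens_swap_gproj n x :
  tens_swapL (tens_gprojL n x) = tens_gprojL n (tens_swapL x).
Proof.
elim/tens_homog_ind: x => [|x y hx hy|p q v w vp wq].
- by rewrite !linear0.
- by rewrite !linearD hx hy.
rewrite /= tens_mapE (tens_gprojE n vp wq).
rewrite (tens_gprojE n (homog_swap vp) (homog_swap wq)).
case: ifP => _; first by rewrite tens_mapE.
by rewrite (linear0 tens_swapL).
Qed.

Definition tens_s2mod : s2mod K :=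
  @S2mod K (tensor V W) tens_gprojL tens_gproj_orth tens_gproj_sum
    tens_swapL tens_swapK tens_swap_gproj.

Lemma homog_tens n p (v : V) (w : W) :
  homogeneous n v -> homogeneous p w ->
  @homogeneous K tens_s2mod (n + p) (v ⊗ w).
Proof.
by move=> vn wp; rewrite /homogeneous /= (tens_gprojE _ vn wp) eqxx.
Qed.

End GradedTensor.

Section DirectSum.
Variables (K : fieldType) (V W : s2mod K).

Lemma dsum_gproj_linear n :
  linear (fun x : V * W => (gproj n x.1, gproj n x.2)).
Proof. by move=> c x y /=; rewrite !linearP. Qed.

Lemma dsum_swap_linear : linear (fun x : V * W => (swap x.1, swap x.2)).
Proof. by move=> c x y /=; rewrite !linearP. Qed.

Definition dsum_gproj n : {linear (V * W)%type -> (V * W)%type} :=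
  mk_linear (dsum_gproj_linear n).
Definition dsum_swap : {linear (V * W)%type -> (V * W)%type} :=
  mk_linear dsum_swap_linear.

Lemma dsum_gproj_orth m n x :
  dsum_gproj m (dsum_gproj n x) = if m == n then dsum_gproj n x else 0.
Proof. by case: x => v w /=; rewrite !gproj_orth; case: ifP. Qed.

Lemma dsum_gproj_sum x :
  exists2 s : seq int, uniq s & x = \sum_(n <- s) dsum_gproj n x.
Proof.
case: x => v w.
have [s [us h h']] := finsupp_seq (gproj_finsupp v) (gproj_finsupp w).
exists s => //; apply: injective_projections => /=.
  by rewrite (raddf_sum fst) /= -(gprojE us h).
by rewrite (raddf_sum snd) /= -(gprojE us h').
Qed.

Lemma dsum_swapK : involutive dsum_swap.
Proof. by case=> v w /=; rewrite !swapK. Qed.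

Lemma dsum_swap_gproj n x : dsum_swap (dsum_gproj n x) = dsum_gproj n (dsum_swap x).
Proof. by case: x => v w /=; rewrite !swap_gproj. Qed.

Definition dsum_s2mod : s2mod K :=
  @S2mod K (V * W)%type dsum_gproj dsum_gproj_orth dsum_gproj_sum
    dsum_swap dsum_swapK dsum_swap_gproj.

Lemma dsum_inl_linear : linear (fun v : V => (v, 0) : dsum_s2mod).
Proof. by move=> c x y; congr pair; rewrite /= scaler0 addr0. Qed.

Lemma dsum_inr_linear : linear (fun w : W => (0, w) : dsum_s2mod).
Proof. by move=> c x y; congr pair; rewrite /= scaler0 addr0. Qed.

Definition dsum_inl : {linear V -> dsum_s2mod} := mk_linear dsum_inl_linear.
Definition dsum_inr : {linear W -> dsum_s2mod} := mk_linear dsum_inr_linear.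

End DirectSum.

Section UnitModules.
Variable K : fieldType.

Lemma trivial_gproj_linear (n : int) :
  linear (fun x : K^o => if n == 0 then x else 0).
Proof. by move=> c x y; case: ifP => _ //; rewrite scaler0 addr0. Qed.

Definition trivial_gproj n : {linear K^o -> K^o} :=
  mk_linear (trivial_gproj_linear n).

Lemma trivial_gproj_orth m n x :
  trivial_gproj m (trivial_gproj n x) = if m == n then trivial_gproj n x else 0.
Proof.
rewrite /=; case: (n =P 0) => [->|_]; first by case: ifP.
by rewrite !if_same.
Qed.

Lemma trivial_gproj_sum x :
  exists2 s : seq int, uniq s & x = \sum_(n <- s) trivial_gproj n x.
Proof. by exists [:: 0] => //; rewrite big_seq1. Qed.

Lemma idfun_swap_gproj (n : int) (x : K^o) :
  (idfun : {linear K^o -> K^o}) (trivial_gproj n x) =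
  trivial_gproj n ((idfun : {linear K^o -> K^o}) x).
Proof. by []. Qed.

Definition trivial_s2mod : s2mod K :=
  @S2mod K K^o trivial_gproj trivial_gproj_orth trivial_gproj_sum
    idfun (fun=> erefl) idfun_swap_gproj.

Lemma zero_gproj_orth (m n : int) (x : 'rV[K]_0) :
  (idfun : {linear 'rV[K]_0 -> 'rV[K]_0}) (idfun x) =
  if m == n then idfun x else 0.
Proof. by rewrite [x]thinmx0 /= if_same. Qed.

Lemma zero_gproj_sum (x : 'rV[K]_0) :
  exists2 s : seq int, uniq s &
    x = \sum_(n <- s) (idfun : {linear 'rV[K]_0 -> 'rV[K]_0}) x.
Proof. by exists [::] => //; rewrite [x]thinmx0 big_nil. Qed.

Definition zero_s2mod : s2mod K :=
  @S2mod K 'rV[K]_0 (fun=> idfun) zero_gproj_orth zero_gproj_sum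
    idfun (fun=> erefl) (fun _ _ => erefl).

End UnitModules.

Section Arity3.
Variable K : fieldType.

(* The arity 3 component of the free operad on V, with leaves x_0, x_1, x_2:
   [tau i a b] is the composite a(b(x_{i+1}, x_{i+2}), x_i), indices mod 3,
   so that tau_1, tau_2, tau_3 are the cases i = 2, 0, 1. *)
Definition T3 (V : lmodType K) := {ffun 'I_3 -> tensor V V}.

Definition tau (V : lmodType K) (i : 'I_3) (a b : V) : T3 V :=
  [ffun j => if j == i then a ⊗ b else 0].

Definition T3_map (V W : lmodType K) (f : {linear V -> W}) (t : T3 V) : T3 W :=
  [ffun i => tens_map f f (t i)].

(* Permuting the leaves by s turns [tau i a b] into [tau (s i) a b] if s is
   even, and into [tau (s i) a (swap b)] if s is odd, since an odd s reverses
   the cyclic order of the two upper leaves. *)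
Definition T3_act (V : s2mod K) (s : 'S_3) (t : T3 V) : T3 V :=
  [ffun i => let x := t ((s^-1)%g i) in
             if odd_perm s then tens_map idfun swap x else x].

Definition T3_gproj (V : s2mod K) (n : int) (t : T3 V) : T3 V :=
  [ffun i => tens_gproj n (t i)].

(* Graded sub-S_3-modules. *)
Record sub_S3 (V : s2mod K) (R : set (T3 V)) : Prop := SubS3 {
  sub_S3_0 : R 0;
  sub_S3_linear : forall c x y, R x -> R y -> R (c *: x + y);
  sub_S3_act : forall s x, R x -> R (T3_act s x);
  sub_S3_gproj : forall n x, R x -> R (T3_gproj n x)
}.

End Arity3.

Record boqd (K : fieldType) := Boqd {
  gens :> s2mod K;
  rels : set (T3 gens);
  rels_sub : sub_S3 rels
}.
Arguments rels {K} b _.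

Record boqd_hom (K : fieldType) (A B : boqd K) := BoqdHom {
  hom_map :> {linear A -> B};
  hom_gproj : forall n a, hom_map (gproj n a) = gproj n (hom_map a);
  hom_swap : forall a, hom_map (swap a) = swap (hom_map a);
  hom_rels : forall r, rels A r -> rels B (T3_map hom_map r)
}.

Section SpanTheory.
Variables (K : fieldType) (U : lmodType K).

Lemma span_gen (G : set U) x : G x -> span G x.
Proof. by move=> Gx; rewrite -[x]addr0 -[x]scale1r; apply: spanD => //; left. Qed.

Lemma span_linear (G : set U) c x y : span G x -> span G y -> span G (c *: x + y).
Proof.
move=> Gx Gy; elim: Gx => [|d g z Gg Gz IH]; first by rewrite scaler0 add0r.
by rewrite scalerDr scalerA -addrA; apply: spanD.
Qed.

Lemma span_sum (G : set U) (I : eqType) (r : seq I) (F : I -> U) :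
  (forall i, i \in r -> span G (F i)) -> span G (\sum_(i <- r) F i).
Proof.
elim: r => [|i r IH] h; first by rewrite big_nil; left.
rewrite big_cons -[F i]scale1r. apply: span_linear; first by apply: h; rewrite mem_head.
by apply: IH => j jr; apply: h; rewrite inE jr orbT.
Qed.

End SpanTheory.

Lemma span_map (K : fieldType) (U V : lmodType K) (G : set U) (H : set V)
    (f : U -> V) : linear f ->
  (forall x, G x -> span H (f x)) -> forall x, span G x -> span H (f x).
Proof.
move=> fL h x; pose f' := mk_linear fL.
elim=> [|c g y Gg _ IH]; first by rewrite (linear0 f' : f 0 = 0); left.
by rewrite fL; apply: span_linear => //; apply: h.
Qed.

Section Arity3Theory.
Variable K : fieldType.
Implicit Types V W : s2mod K.

Lemma T3_act_linear V s : linear (@T3_act K V s).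
Proof.
by move=> c x y; apply/ffunP => i; rewrite !ffunE /=; case: ifP => // _; rewrite linearP.
Qed.

Lemma T3_gproj_linear V n : linear (@T3_gproj K V n).
Proof. by move=> c x y; apply/ffunP => i; rewrite !ffunE /= tens_gproj_linear. Qed.

Lemma T3_map_linear V W (f : {linear V -> W}) : linear (T3_map f).
Proof. by move=> c x y; apply/ffunP => i; rewrite !ffunE /= linearP. Qed.

Lemma T3_actD V s (x y : T3 V) : T3_act s (x + y) = T3_act s x + T3_act s y.
Proof. exact: (linearD (mk_linear (@T3_act_linear V s))). Qed.

Lemma T3_act0 V s : T3_act s (0 : T3 V) = 0.
Proof. exact: (linear0 (mk_linear (@T3_act_linear V s))). Qed.

Lemma T3_gprojD V n (x y : T3 V) : T3_gproj n (x + y) = T3_gproj n x + T3_gproj n y.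
Proof. exact: (linearD (mk_linear (@T3_gproj_linear V n))). Qed.

Lemma T3_gproj0 V n : T3_gproj n (0 : T3 V) = 0.
Proof. exact: (linear0 (mk_linear (@T3_gproj_linear V n))). Qed.

Lemma T3_gprojZ V n c (x : T3 V) : T3_gproj n (c *: x) = c *: T3_gproj n x.
Proof. exact: (linearZ_LR (mk_linear (@T3_gproj_linear V n))). Qed.

Lemma T3_mapD V W (f : {linear V -> W}) x y :
  T3_map f (x + y) = T3_map f x + T3_map f y.
Proof. exact: (linearD (mk_linear (@T3_map_linear V W f))). Qed.

Lemma T3_map0 V W (f : {linear V -> W}) : T3_map f 0 = 0.
Proof. exact: (linear0 (mk_linear (@T3_map_linear V W f))). Qed.

Lemma T3_mapZ V W (f : {linear V -> W}) c x : T3_map f (c *: x) = c *: T3_map f x.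
Proof. exact: (linearZ_LR (mk_linear (@T3_map_linear V W f))). Qed.

Lemma tens_map_comp (U1 U2 U3 V1 V2 V3 : lmodType K)
    (f : {linear U1 -> U2}) (g : {linear V1 -> V2})
    (f' : {linear U2 -> U3}) (g' : {linear V2 -> V3}) x :
  tens_map f' g' (tens_map f g x) = tens_map (f' \o f) (g' \o g) x.
Proof.
elim/tens_ind: x => [|x y hx hy|u v]; first by rewrite !tens_map0.
  by rewrite !tens_mapD hx hy.
by rewrite !tens_mapE.
Qed.

Lemma tens_map_ext (U1 U2 V1 V2 : lmodType K)
    (f f' : {linear U1 -> U2}) (g g' : {linear V1 -> V2}) x :
  f =1 f' -> g =1 g' -> tens_map f g x = tens_map f' g' x.
Proof.
move=> ff gg; elim/tens_ind: x => [|x y hx hy|u v]; first by rewrite !tens_map0.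
  by rewrite !tens_mapD hx hy.
by rewrite !tens_mapE ff gg.
Qed.

Lemma tens_map_id (U V : lmodType K) (f : {linear U -> U}) (g : {linear V -> V}) x :
  f =1 id -> g =1 id -> tens_map f g x = x.
Proof.
move=> f1 g1; elim/tens_ind: x => [|x y hx hy|u v]; first by rewrite !tens_map0.
  by rewrite !tens_mapD hx hy.
by rewrite !tens_mapE f1 g1.
Qed.

Lemma T3_actM V s s' (t : T3 V) : T3_act s (T3_act s' t) = T3_act (s' * s)%g t.
Proof.
apply/ffunP => i; rewrite !ffunE /= invMg permM odd_permM.
case: (odd_perm s); case: (odd_perm s') => //=.
by rewrite tens_map_comp tens_map_id // => v /=; rewrite swapK.
Qed.

Lemma T3_gproj_act V n s (t : T3 V) :
  T3_gproj n (T3_act s t) = T3_act s (T3_gproj n t).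
Proof.
apply/ffunP => i; rewrite !ffunE /=; case: ifP => // _.
elim/tens_homog_ind: (t _) => [|x y hx hy|p q v w vp wq].
- by rewrite !(tens_map0, tens_gproj0).
- by rewrite !(tens_mapD, tens_gprojD) hx hy.
rewrite tens_mapE (tens_gprojE n vp wq) (tens_gprojE n (vp : homogeneous p (idfun v)) (homog_swap wq)).
by case: ifP => _; rewrite ?tens_map0 ?tens_mapE.
Qed.

Lemma T3_map_act V W (f : {linear V -> W}) s (t : T3 V) :
  (forall v, f (swap v) = swap (f v)) ->
  T3_map f (T3_act s t) = T3_act s (T3_map f t).
Proof.
move=> fs; apply/ffunP => i; rewrite !ffunE /=; case: ifP => // _.
by rewrite !tens_map_comp; apply: tens_map_ext => v //=; rewrite fs.
Qed.

Lemma tens_map_gproj V V' W W' (f : {linear V -> V'}) (g : {linear W -> W'}) n x :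
  (forall n v, f (gproj n v) = gproj n (f v)) ->
  (forall n w, g (gproj n w) = gproj n (g w)) ->
  tens_map f g (tens_gproj n x) = tens_gproj n (tens_map f g x).
Proof.
move=> fp gp; elim/tens_homog_ind: x => [|x y hx hy|p q v w vp wq].
- by rewrite !(tens_map0, tens_gproj0).
- by rewrite !(tens_mapD, tens_gprojD) hx hy.
have fvp : homogeneous p (f v) by rewrite /homogeneous -fp vp.
have gwq : homogeneous q (g w) by rewrite /homogeneous -gp wq.
rewrite tens_mapE (tens_gprojE n vp wq) (tens_gprojE n fvp gwq).
by case: ifP => _; rewrite ?tens_map0 ?tens_mapE.
Qed.

Lemma T3_map_gproj V W (f : {linear V -> W}) n (t : T3 V) :
  (forall n v, f (gproj n v) = gproj n (f v)) ->
  T3_map f (T3_gproj n t) = T3_gproj n (T3_map f t).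
Proof. by move=> fp; apply/ffunP => i; rewrite !ffunE /= tens_map_gproj. Qed.

Lemma T3_map_comp V W (U : s2mod K) (f : {linear V -> W}) (g : {linear W -> U})
    (h : {linear V -> U}) t :
  (forall v, g (f v) = h v) -> T3_map g (T3_map f t) = T3_map h t.
Proof.
move=> gf; apply/ffunP => i; rewrite !ffunE /= tens_map_comp.
by apply: tens_map_ext => v /=; rewrite gf.
Qed.

Lemma T3_map_id V (f : {linear V -> V}) t : f =1 id -> T3_map f t = t.
Proof. by move=> f1; apply/ffunP => i; rewrite !ffunE /= tens_map_id. Qed.

Lemma T3_gproj_sum V (t : T3 V) :
  exists s : seq int, t = \sum_(n <- s) T3_gproj n t.
Proof.
have h i : exists s : seq int, forall p, p \notin s -> tens_gproj p (t i) = 0.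
  by have [s [_ _ h]] := gproj_supp (t i : tens_s2mod V V); exists s.
have [s hs] := choice h.
pose S := undup (flatten [seq s i | i <- enum 'I_3]).
have S0 i p : p \notin S -> tens_gproj p (t i) = 0.
  rewrite mem_undup => pS; apply: hs; apply: contra pS => ps.
  by apply/flatten_mapP; exists i => //; rewrite mem_enum.
exists S; apply/ffunP => i; rewrite sum_ffunE.
rewrite {1}(gprojE (V := tens_s2mod V V) (undup_uniq _) (@S0 i)).
by apply: eq_bigr => n _; rewrite ffunE.
Qed.

Lemma T3_map_tau V W (f : {linear V -> W}) i a b :
  T3_map f (tau i a b) = tau i (f a) (f b).
Proof.
by apply/ffunP => j; rewrite !ffunE; case: ifP; rewrite ?tens_mapE ?tens_map0.
Qed.

Lemma T3_gproj_tau V n p q i (a b : V) : homogeneous p a -> homogeneous q b ->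
  T3_gproj n (tau i a b) = if n == p + q then tau i a b else 0.
Proof.
move=> ap bq; apply/ffunP => j; rewrite ffunE [tau i a b j]ffunE.
case: ifP => ji; rewrite ?tens_gproj0 ?(tens_gprojE n ap bq);
  by case: ifP => _; rewrite !ffunE ?ji.
Qed.

End Arity3Theory.

Section KoszulInterchange.
Variables (K : fieldType) (V W : s2mod K).
Let VW := tens_s2mod V W.

Definition koszul_quad (a a' : V) (b b' : W) : tensor VW VW :=
  \sum_(p \in [set: int]) \sum_(q \in [set: int])
    (-1) ^ (p * q) *: ((a ⊗ gproj q b) ⊗ (gproj p a' ⊗ b')).

(* The linear map (a (x) a') (x) (b (x) b') |->
   (-1)^(|a'| |b|) (a (x) b) (x) (a' (x) b'), see [koszul_midE]. *)
Definition koszul_mid (x : tensor V V) (y : tensor W W) : tensor VW VW :=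
  tens_lift (fun a a' => tens_lift (koszul_quad a a') y) x.

Let fin (a a' : V) (b b' : W) p :
  finsupp (fun q => (-1) ^ (p * q) *: ((a ⊗ gproj q b) ⊗ (gproj p a' ⊗ b') : tensor VW VW)).
Proof.
have [s [_ _ s0]] := gproj_supp b; exists s => q /s0 ->.
by rewrite tens0r tens0l scaler0.
Qed.

Let fin' (a a' : V) (b b' : W) :
  finsupp (fun p => \sum_(q \in [set: int])
    (-1) ^ (p * q) *: ((a ⊗ gproj q b) ⊗ (gproj p a' ⊗ b') : tensor VW VW)).
Proof.
have [s [_ _ s0]] := gproj_supp a'; exists s => p /s0 ->.
by rewrite (@fsum1 _ _ _ 0) => [|q _]; rewrite tens0l tens0r scaler0.
Qed.

Let tl (U U' : lmodType K) c (u v : U) (w : U') :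
  (c *: u + v) ⊗ w = c *: (u ⊗ w) + v ⊗ w.
Proof. by case: (@tens_bilinear K U U') => l r; first [exact: l | exact: r]. Qed.

Let tr (U U' : lmodType K) c (u v : U') (w : U) :
  w ⊗ (c *: u + v) = c *: (w ⊗ u) + w ⊗ v.
Proof. by case: (@tens_bilinear K U U') => l r; first [exact: l | exact: r]. Qed.

Lemma koszul_quad_linear c (a1 a2 a1' a2' : V) (b1 b2 b1' b2' : W) :
  [/\ koszul_quad (c *: a1 + a2) a1' b1 b1' =
        c *: koszul_quad a1 a1' b1 b1' + koszul_quad a2 a1' b1 b1',
      koszul_quad a1 (c *: a1' + a2') b1 b1' =
        c *: koszul_quad a1 a1' b1 b1' + koszul_quad a1 a2' b1 b1',
      koszul_quad a1 a1' (c *: b1 + b2) b1' =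
        c *: koszul_quad a1 a1' b1 b1' + koszul_quad a1 a1' b2 b1' &
      koszul_quad a1 a1' b1 (c *: b1' + b2') =
        c *: koszul_quad a1 a1' b1 b1' + koszul_quad a1 a1' b1 b2'].
Proof.
rewrite /koszul_quad; split; rewrite -fsum_linear //;
  apply: eq_fsbigr => p _; rewrite -fsum_linear //;
  apply: eq_fsbigr => q _; rewrite ?linearP ?(tl, tr);
  by rewrite scalerDr !scalerA (mulrC _ c).
Qed.

Lemma koszul_quad_bilinear a a' : bilinear_map (koszul_quad a a').
Proof.
split=> [b' c b1 b2 | b c b1 b2].
  by have [_ _ ->] := koszul_quad_linear c a a a' a' b1 b2 b' b'.
by have [_ _ _ ->] := koszul_quad_linear c a a a' a' b b b1 b2.
Qed.

Lemma koszul_lift_bilinear y :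
  bilinear_map (fun a a' => tens_lift (koszul_quad a a') y).
Proof.
split=> [a' c a1 a2 | a c a1 a2]; rewrite /tens_lift /eval_sum scaler_sumr -big_split;
  apply: eq_bigr => -[b b'] _ /=.
  by have [-> _ _] := koszul_quad_linear c a1 a2 a' a' b b b' b'.
by have [_ -> _] := koszul_quad_linear c a a a1 a2 b b b' b'.
Qed.

Lemma koszul_mid_bilinear : bilinear_map koszul_mid.
Proof.
split=> [y c x x' | x c y y']; rewrite /koszul_mid.
  exact/tens_lift_linear/koszul_lift_bilinear.
rewrite {1 3 4}/tens_lift /eval_sum scaler_sumr -big_split.
apply: eq_bigr => -[a a'] _ /=.
exact/tens_lift_linear/koszul_quad_bilinear.
Qed.

Lemma koszul_midE p q a a' b b' : homogeneous p a' -> homogeneous q b ->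
  koszul_mid (a ⊗ a') (b ⊗ b') = (-1) ^ (p * q) *: ((a ⊗ b) ⊗ (a' ⊗ b')).
Proof.
move=> ap bq; rewrite /koszul_mid tens_liftE; last exact: koszul_lift_bilinear.
rewrite tens_liftE; last exact: koszul_quad_bilinear.
rewrite /koszul_quad (@fsum1 _ _ _ p) => [|p' pp]; last first.
  rewrite (gproj_homog _ ap) (negbTE pp) (@fsum1 _ _ _ 0) => [|q' _];
    by rewrite tens0l tens0r scaler0.
rewrite (@fsum1 _ _ _ q) => [|q' qq]; last first.
  by rewrite (gproj_homog _ bq) (negbTE qq) tens0r tens0l scaler0.
by rewrite ap bq.
Qed.

Lemma koszul_mid0l y : koszul_mid 0 y = 0.
Proof. by rewrite -[0](scale0r 0) (bilinZl _ _ _ koszul_mid_bilinear) scale0r. Qed.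

Lemma koszul_mid0r x : koszul_mid x 0 = 0.
Proof. by rewrite -[X in koszul_mid x X](scale0r 0) (bilinZr _ _ _ koszul_mid_bilinear) scale0r. Qed.

Lemma koszul_midDl x x' y : koszul_mid (x + x') y = koszul_mid x y + koszul_mid x' y.
Proof. exact: (bilinDl _ _ _ koszul_mid_bilinear). Qed.

Lemma koszul_midDr x y y' : koszul_mid x (y + y') = koszul_mid x y + koszul_mid x y'.
Proof. exact: (bilinDr _ _ _ koszul_mid_bilinear). Qed.

Lemma koszul_mid_gproj n p q x y :
  @tens_gproj K VW VW n (koszul_mid (tens_gproj p x) (tens_gproj q y)) =
  if n == p + q then koszul_mid (tens_gproj p x) (tens_gproj q y) else 0.
Proof.
elim/tens_homog_ind: x => [|x x' hx hx'|m m' a a' am am'].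
- by rewrite !(tens_gproj0, koszul_mid0l) if_same.
- by rewrite !(tens_gprojD, koszul_midDl) hx hx'; case: ifP; rewrite ?addr0.
rewrite (tens_gprojE p am am'); case: (p =P m + m') => [->|_]; last first.
  by rewrite koszul_mid0l tens_gproj0 if_same.
elim/tens_homog_ind: y => [|y y' hy hy'|k k' b b' bk bk'].
- by rewrite !(tens_gproj0, koszul_mid0r) if_same.
- by rewrite !(tens_gprojD, koszul_midDr) hy hy'; case: ifP; rewrite ?addr0.
rewrite (tens_gprojE q bk bk'); case: (q =P k + k') => [->|_]; last first.
  by rewrite koszul_mid0r tens_gproj0 if_same.
rewrite (koszul_midE _ _ am' bk).
have h := tens_gprojE n (homog_tens am bk) (homog_tens am' bk').
rewrite tens_gprojZ h.
rewrite (addrACA m k m' k').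
by case: ifP; rewrite ?scaler0.
Qed.

End KoszulInterchange.

Section KoszulNaturality.
Variables (K : fieldType) (V V' W W' : s2mod K).

Lemma koszul_mid_map (f g : {linear V -> V'}) (f' g' : {linear W -> W'}) x y :
  (forall n v, g (gproj n v) = gproj n (g v)) ->
  (forall n w, f' (gproj n w) = gproj n (f' w)) ->
  tens_map (tens_map f f') (tens_map g g') (koszul_mid x y) =
  koszul_mid (tens_map f g x) (tens_map f' g' y) :> tensor (tens_s2mod V' W') (tens_s2mod V' W').
Proof.
move=> gp fp.
elim/tens_homog_ind: x => [|x x' hx hx'|m m' a a' am am'].
- by rewrite !(tens_map0, koszul_mid0l).
- by rewrite !(tens_mapD, koszul_midDl) hx hx'.
elim/tens_homog_ind: y => [|y y' hy hy'|k k' b b' bk bk'].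
- by rewrite !(tens_map0, koszul_mid0r).
- by rewrite !(tens_mapD, koszul_midDr) hy hy'.
have gam : homogeneous m' (g a') by rewrite /homogeneous -gp am'.
have fbk : homogeneous k (f' b) by rewrite /homogeneous -fp bk.
rewrite (koszul_midE _ _ am' bk) !tens_mapE (koszul_midE _ _ gam fbk).
by rewrite tens_mapZ !tens_mapE /= !tens_mapE.
Qed.

End KoszulNaturality.

Section BlackProduct.
Variable K : fieldType.

Definition psi (V W : s2mod K) (r : T3 V) (s : T3 W) : T3 (tens_s2mod V W) :=
  [ffun i => koszul_mid (r i) (s i)].

Definition black_rels (V W : s2mod K) (R : set (T3 V)) (S : set (T3 W)) :
    set (T3 (tens_s2mod V W)) :=
  span [set psi r s | r in R & s in S].

Lemma psiE (V W : s2mod K) i j (a a' : V) (b b' : W) p q :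
  homogeneous p a' -> homogeneous q b ->
  psi (tau i a a') (tau j b b') =
  if i == j then (-1) ^ (p * q) *: (tau i (a ⊗ b) (a' ⊗ b') : T3 (tens_s2mod V W))
  else 0.
Proof.
move=> ap bq; apply/ffunP => k; rewrite !ffunE.
case: (i =P j) => [<-|/eqP ij].
  rewrite !ffunE; case: ifP => _; first exact: koszul_midE.
  by rewrite koszul_mid0l scaler0.
rewrite !ffunE; case: (k =P i) => [->|_]; last by rewrite koszul_mid0l.
by rewrite (negbTE ij) koszul_mid0r.
Qed.

Lemma psi_bilinear (V W : s2mod K) : bilinear_map (@psi V W).
Proof.
have [l r] := koszul_mid_bilinear V W.
by split=> [y c x x'|x c y y']; apply/ffunP => i; rewrite !ffunE ?l ?r.
Qed.

Lemma psi_act (V W : s2mod K) s (x : T3 V) (y : T3 W) :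
  T3_act s (psi x y) = psi (T3_act s x) (T3_act s y).
Proof.
apply/ffunP => i; rewrite !ffunE /=; case: ifP => // _.
rewrite -koszul_mid_map //; last by move=> n v; rewrite swap_gproj.
by apply: tens_map_ext => // v; rewrite /= tens_map_id.
Qed.

Lemma psi_map (V V' W W' : s2mod K) (f : {linear V -> V'}) (g : {linear W -> W'})
    (x : T3 V) (y : T3 W) :
  (forall n v, f (gproj n v) = gproj n (f v)) ->
  (forall n w, g (gproj n w) = gproj n (g w)) ->
  T3_map (tens_map f g : {linear tens_s2mod V W -> tens_s2mod V' W'}) (psi x y) =
  psi (T3_map f x) (T3_map g y).
Proof. by move=> fp gp; apply/ffunP => i; rewrite !ffunE /= -koszul_mid_map. Qed.

Lemma black_rels_sub (V W : s2mod K) (R : set (T3 V)) (S : set (T3 W)) :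
  sub_S3 R -> sub_S3 S -> sub_S3 (black_rels R S).
Proof.
move=> Rs Ss; split; first exact: span0.
- exact: span_linear.
- move=> s; apply: span_map; first exact: T3_act_linear.
  move=> _ [r Rr [t St <-]]; rewrite psi_act; apply: span_gen.
  by exists (T3_act s r); [exact: sub_S3_act | exists (T3_act s t) => //; exact: sub_S3_act].
move=> n; apply: span_map; first exact: T3_gproj_linear.
move=> _ [r Rr [t St <-]].
have [P rE] := T3_gproj_sum r; have [Q tE] := T3_gproj_sum t.
have B := @psi_bilinear V W.
have -> : psi r t = \sum_(p <- P) \sum_(q <- Q) psi (T3_gproj p r) (T3_gproj q t).
  have sl (y : T3 W) (F : int -> T3 V) : psi (\sum_(p <- P) F p) y = \sum_(p <- P) psi (F p) y.
    exact: (linear_sum (mk_linear (B.1 y))).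
  have sr (x : T3 V) (F : int -> T3 W) : psi x (\sum_(q <- Q) F q) = \sum_(q <- Q) psi x (F q).
    exact: (linear_sum (mk_linear (B.2 x))).
  by rewrite {1}rE sl; apply: eq_bigr => p _; rewrite {1}tE sr.
have sg (I : Type) (J : seq I) (F : I -> T3 (tens_s2mod V W)) :
    T3_gproj n (\sum_(i <- J) F i) = \sum_(i <- J) T3_gproj n (F i).
  exact: (linear_sum (mk_linear (@T3_gproj_linear K (tens_s2mod V W) n))).
rewrite sg; apply: span_sum => p _; rewrite sg; apply: span_sum => q _.
have -> : T3_gproj n (psi (T3_gproj p r) (T3_gproj q t)) =
    if n == p + q then psi (T3_gproj p r) (T3_gproj q t) else 0.
  apply/ffunP => i; rewrite !ffunE koszul_mid_gproj.
  by case: ifP => _; rewrite !ffunE.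
case: ifP => _; last exact: span0.
apply: span_gen; exists (T3_gproj p r); first exact: sub_S3_gproj.
by exists (T3_gproj q t) => //; exact: sub_S3_gproj.
Qed.

Definition black (A B : boqd K) : boqd K :=
  @Boqd K (tens_s2mod A B) (black_rels (rels A) (rels B))
    (black_rels_sub (rels_sub A) (rels_sub B)).

Definition black_unit_rels : set (T3 (trivial_s2mod K)) :=
  span [set \sum_(i < 3) tau i (1 : K^o) (1 : K^o)].

Lemma sum_tau (V : lmodType K) (a b : V) j : (\sum_(i < 3) tau i a b) j = a ⊗ b.
Proof.
rewrite sum_ffunE (bigD1 j) //= ffunE eqxx big1 ?addr0 // => i ij.
by rewrite ffunE eq_sym (negbTE ij).
Qed.

Lemma black_unit_sub : sub_S3 black_unit_rels.
Proof.
split; [exact: span0 | exact: span_linear | move=> s | move=> n].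
  apply: span_map => [|_ ->]; first exact: T3_act_linear.
  apply: span_gen; apply/ffunP => i; rewrite ffunE /= !sum_tau.
  by case: ifP; rewrite ?tens_mapE.
apply: span_map => [|_ ->]; first exact: T3_gproj_linear.
have h : homogeneous 0 (1 : trivial_s2mod K) by [].
case: (n =P 0) => [->|/eqP n0].
  apply: span_gen; apply/ffunP => i.
  by rewrite ffunE !sum_tau (tens_gprojE _ h h).
rewrite (_ : T3_gproj _ _ = 0); first exact: span0.
apply/ffunP => i; rewrite !ffunE sum_tau (tens_gprojE _ h h) addr0.
by rewrite (negbTE n0).
Qed.

Definition black_unit : boqd K := Boqd black_unit_sub.

End BlackProduct.

Section CircProduct.
Variable K : fieldType.

Definition mix_gen (V W : s2mod K) : set (T3 (dsum_s2mod V W)) :=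
  [set t | exists p q (a : V) (b : W),
    [/\ homogeneous p a, homogeneous q b,
        (swap a = a /\ swap b = b) \/ (swap a = - a /\ swap b = - b) &
        t = tau ord_max (dsum_inl V W a) (dsum_inr V W b) +
            (-1) ^ (p * q) *: tau ord_max (dsum_inr V W b) (dsum_inl V W a)]].

(* The sub-S_3-module generated by [mix_gen]. *)
Definition mix_rels (V W : s2mod K) : set (T3 (dsum_s2mod V W)) :=
  span [set T3_act s t | s in setT & t in @mix_gen V W].

Definition circ_rels (V W : s2mod K) (R : set (T3 V)) (S : set (T3 W)) :
    set (T3 (dsum_s2mod V W)) :=
  [set t | exists r m s, [/\ R r, @mix_rels V W m, S s &
     t = T3_map (dsum_inl V W) r + m + T3_map (dsum_inr V W) s]].

Lemma dsum_inl_swap (V W : s2mod K) v :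
  dsum_inl V W (swap v) = @swap K (dsum_s2mod V W) (dsum_inl V W v).
Proof. by congr pair; rewrite /= linear0. Qed.

Lemma dsum_inr_swap (V W : s2mod K) w :
  dsum_inr V W (swap w) = @swap K (dsum_s2mod V W) (dsum_inr V W w).
Proof. by congr pair; rewrite /= linear0. Qed.

Lemma dsum_inl_gproj (V W : s2mod K) n v :
  dsum_inl V W (gproj n v) = @gproj K (dsum_s2mod V W) n (dsum_inl V W v).
Proof. by congr pair; rewrite /= linear0. Qed.

Lemma dsum_inr_gproj (V W : s2mod K) n w :
  dsum_inr V W (gproj n w) = @gproj K (dsum_s2mod V W) n (dsum_inr V W w).
Proof. by congr pair; rewrite /= linear0. Qed.

Lemma mix_rels_sub (V W : s2mod K) : sub_S3 (@mix_rels V W).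
Proof.
split; [exact: span0 | exact: span_linear | move=> s | move=> n].
  apply: span_map; first exact: T3_act_linear.
  move=> _ [s' _ [t Gt <-]]; rewrite T3_actM; apply: span_gen.
  by exists (s' * s)%g => //; exists t.
apply: span_map; first exact: T3_gproj_linear.
move=> _ [s _ [t Gt <-]]; rewrite T3_gproj_act.
case: (Gt) => p [q [a [b [ap bq _ tE]]]].
have ap' : @homogeneous K (dsum_s2mod V W) p (dsum_inl V W a).
  by rewrite /homogeneous -dsum_inl_gproj ap.
have bq' : @homogeneous K (dsum_s2mod V W) q (dsum_inr V W b).
  by rewrite /homogeneous -dsum_inr_gproj bq.
have -> : T3_gproj n t = if n == p + q then t else 0.
  rewrite tE T3_gprojD T3_gprojZ.
  rewrite (T3_gproj_tau _ _ ap' bq') (T3_gproj_tau _ _ bq' ap') (addrC q).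
  by case: ifP; rewrite ?scaler0 ?addr0.
case: ifP => _; first by apply: span_gen; exists s => //; exists t.
by rewrite T3_act0; exact: span0.
Qed.

Lemma circ_rels_sub (V W : s2mod K) (R : set (T3 V)) (S : set (T3 W)) :
  sub_S3 R -> sub_S3 S -> sub_S3 (circ_rels R S).
Proof.
move=> Rs Ss; have Ms := mix_rels_sub V W.
split.
- exists 0, 0, 0; split; try exact: sub_S3_0.
  by rewrite !T3_map0 !addr0.
- move=> c _ _ [r [m [s [Rr Mm Ss' ->]]]] [r' [m' [s' [Rr' Mm' Ss'' ->]]]].
  exists (c *: r + r'), (c *: m + m'), (c *: s + s'); split; try exact: sub_S3_linear.
  by rewrite !T3_map_linear !scalerDr [LHS]addrACA; congr (_ + _); rewrite addrACA.
- move=> s _ [r [m [t [Rr Mm St ->]]]].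
  exists (T3_act s r), (T3_act s m), (T3_act s t); split; try exact: sub_S3_act.
  rewrite (T3_map_act _ _ (@dsum_inl_swap V W)) (T3_map_act _ _ (@dsum_inr_swap V W)).
  by rewrite !T3_actD.
move=> n _ [r [m [t [Rr Mm St ->]]]].
exists (T3_gproj n r), (T3_gproj n m), (T3_gproj n t); split; try exact: sub_S3_gproj.
rewrite (T3_map_gproj _ _ (@dsum_inl_gproj V W)) (T3_map_gproj _ _ (@dsum_inr_gproj V W)).
by rewrite !T3_gprojD.
Qed.

Definition circ (A B : boqd K) : boqd K :=
  @Boqd K (dsum_s2mod A B) (circ_rels (rels A) (rels B))
    (circ_rels_sub (rels_sub A) (rels_sub B)).

Lemma zero_rels_sub (V : s2mod K) : sub_S3 [set (0 : T3 V)].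
Proof.
have E (x : T3 V) : [set (0 : T3 V)]%classic x -> x = 0 by [].
split; first by [].
- by move=> c x y /E -> /E ->; rewrite scaler0 addr0.
- by move=> s x /E ->; rewrite T3_act0.
- by move=> n x /E ->; rewrite T3_gproj0.
Qed.

Definition circ_unit : boqd K := Boqd (zero_rels_sub (zero_s2mod K)).

End CircProduct.

Section BoqdCategory.
Variable K : fieldType.
Implicit Types A B C D : boqd K.

Lemma linear_eq (U V : lmodType K) (f g : {linear U -> V}) : f =1 g -> f = g.
Proof.
case: f g => [f cf] [g cg] /= /funext fg; subst g; congr GRing.Linear.Pack.
case: cf cg => [[f1] [f2]] [[g1] [g2]].
by rewrite (Prop_irrelevance f1 g1) (Prop_irrelevance f2 g2).
Qed.

Lemma boqd_hom_eq A B (f g : boqd_hom A B) : hom_map f =1 hom_map g -> f = g.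
Proof.
case: f g => [f f1 f2 f3] [g g1 g2 g3] /= /linear_eq fg.
by subst g; congr BoqdHom; apply: Prop_irrelevance.
Qed.

Lemma boqd_id_rels A r : rels A r -> rels A (T3_map (idfun : {linear A -> A}) r).
Proof. by rewrite T3_map_id. Qed.

Definition boqd_id A : boqd_hom A A :=
  @BoqdHom K A A idfun (fun _ _ => erefl) (fun _ => erefl) (@boqd_id_rels A).

Section Comp.
Variables (A B C : boqd K) (g : boqd_hom B C) (f : boqd_hom A B).

Definition boqd_comp_map : {linear A -> C} := hom_map g \o hom_map f.

Lemma boqd_comp_gproj n a : boqd_comp_map (gproj n a) = gproj n (boqd_comp_map a).
Proof. by rewrite /= !hom_gproj. Qed.

Lemma boqd_comp_swap a : boqd_comp_map (swap a) = swap (boqd_comp_map a).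
Proof. by rewrite /= !hom_swap. Qed.

Lemma boqd_comp_rels r : rels A r -> rels C (T3_map boqd_comp_map r).
Proof.
move=> Ar; rewrite -(@T3_map_comp K A B C (hom_map f) (hom_map g)) //.
by do 2!apply: hom_rels.
Qed.

Definition boqd_comp : boqd_hom A C :=
  BoqdHom boqd_comp_gproj boqd_comp_swap boqd_comp_rels.

End Comp.

Lemma boqd_compA A B C D (h : boqd_hom C D) (g : boqd_hom B C) (f : boqd_hom A B) :
  boqd_comp h (boqd_comp g f) = boqd_comp (boqd_comp h g) f.
Proof. exact: boqd_hom_eq. Qed.

Lemma boqd_comp1m A B (f : boqd_hom A B) : boqd_comp (boqd_id B) f = f.
Proof. exact: boqd_hom_eq. Qed.

Lemma boqd_compm1 A B (f : boqd_hom A B) : boqd_comp f (boqd_id A) = f.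
Proof. exact: boqd_hom_eq. Qed.

Definition BOQD : category :=
  @Category (boqd K) (@boqd_hom K) boqd_id boqd_comp
    boqd_compA boqd_comp1m boqd_compm1.

Section BlackHom.
Variables (A B A' B' : boqd K) (f : boqd_hom A A') (g : boqd_hom B B').

Definition black_map : {linear black A B -> black A' B'} :=
  tens_map (hom_map f) (hom_map g).

Lemma black_map_gproj n x : black_map (gproj n x) = gproj n (black_map x).
Proof. by apply: tens_map_gproj => m v; rewrite hom_gproj. Qed.

Lemma black_map_swap x : black_map (swap x) = swap (black_map x).
Proof.
rewrite /= !tens_map_comp; apply: tens_map_ext => v /=; by rewrite hom_swap.
Qed.

Lemma black_map_rels r : rels (black A B) r -> rels (black A' B') (T3_map black_map r).
Proof.
move: r; apply: span_map; first exact: T3_map_linear.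
move=> _ [r Ar [s Bs <-]]; apply: span_gen.
exists (T3_map (hom_map f) r); first exact: hom_rels.
exists (T3_map (hom_map g) s); first exact: hom_rels.
by rewrite psi_map //; apply: hom_gproj.
Qed.

Definition black_hom : boqd_hom (black A B) (black A' B') :=
  BoqdHom black_map_gproj black_map_swap black_map_rels.

End BlackHom.

Section CircHom.
Variables (A B A' B' : boqd K) (f : boqd_hom A A') (g : boqd_hom B B').

Lemma circ_map_linear :
  linear (fun x : circ A B => (hom_map f x.1, hom_map g x.2) : circ A' B').
Proof. by move=> c x y; congr pair; rewrite /= linearP. Qed.

Definition circ_map : {linear circ A B -> circ A' B'} := mk_linear circ_map_linear.

Lemma circ_map_gproj n x : circ_map (gproj n x) = gproj n (circ_map x).
Proof. by congr pair; rewrite /= hom_gproj. Qed.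

Lemma circ_map_swap x : circ_map (swap x) = swap (circ_map x).
Proof. by congr pair; rewrite /= hom_swap. Qed.

Lemma circ_map_inl a : circ_map (dsum_inl A B a) = dsum_inl A' B' (hom_map f a).
Proof. by congr pair; rewrite /= linear0. Qed.

Lemma circ_map_inr b : circ_map (dsum_inr A B b) = dsum_inr A' B' (hom_map g b).
Proof. by congr pair; rewrite /= linear0. Qed.

Lemma circ_map_mix m : @mix_rels K A B m -> @mix_rels K A' B' (T3_map circ_map m).
Proof.
move: m; apply: span_map; first exact: T3_map_linear.
move=> _ [s _ [t [p [q [a [b [ap bq ab ->]]]]] <-]].
rewrite (T3_map_act _ _ circ_map_swap); apply: span_gen; exists s => //.
eexists; last reflexivity.
exists p, q, (hom_map f a), (hom_map g b); split.
- by rewrite /homogeneous -hom_gproj ap.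
- by rewrite /homogeneous -hom_gproj bq.
- by rewrite -!hom_swap; case: ab => -[-> ->]; [left | right; rewrite !linearN].
rewrite T3_mapD T3_mapZ !T3_map_tau.
by rewrite circ_map_inl circ_map_inr.
Qed.

Lemma circ_map_rels r : rels (circ A B) r -> rels (circ A' B') (T3_map circ_map r).
Proof.
move=> [u [m [v [Au Mm Bv ->]]]].
exists (T3_map (hom_map f) u), (T3_map circ_map m), (T3_map (hom_map g) v).
split; [exact: hom_rels | exact: circ_map_mix | exact: hom_rels |].
rewrite !T3_mapD.
pose h1 : {linear A -> circ A' B'} := circ_map \o dsum_inl A B.
pose h2 : {linear B -> circ A' B'} := circ_map \o dsum_inr A B.
rewrite (@T3_map_comp K A (circ A B) (circ A' B') _ _ h1) //.
rewrite (@T3_map_comp K B (circ A B) (circ A' B') _ _ h2) //.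
rewrite (@T3_map_comp K A A' (circ A' B') _ _ h1) => [|a]; last by rewrite -circ_map_inl.
by rewrite (@T3_map_comp K B B' (circ A' B') _ _ h2) // => b; rewrite -circ_map_inr.
Qed.

Definition circ_hom : boqd_hom (circ A B) (circ A' B') :=
  BoqdHom circ_map_gproj circ_map_swap circ_map_rels.

End CircHom.

Lemma black_hom1 A B : black_hom (boqd_id A) (boqd_id B) = boqd_id (black A B).
Proof. by apply: boqd_hom_eq => x; apply: tens_map_id. Qed.

Lemma black_homM A B A' B' A'' B''
    (f' : boqd_hom A' A'') (g' : boqd_hom B' B'') (f : boqd_hom A A') (g : boqd_hom B B') :
  black_hom (boqd_comp f' f) (boqd_comp g' g) = boqd_comp (black_hom f' g') (black_hom f g).
Proof. by apply: boqd_hom_eq => x; rewrite /= tens_map_comp. Qed.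

Lemma circ_hom1 A B : circ_hom (boqd_id A) (boqd_id B) = boqd_id (circ A B).
Proof. by apply: boqd_hom_eq => -[]. Qed.

Lemma circ_homM A B A' B' A'' B''
    (f' : boqd_hom A' A'') (g' : boqd_hom B' B'') (f : boqd_hom A A') (g : boqd_hom B B') :
  circ_hom (boqd_comp f' f) (boqd_comp g' g) = boqd_comp (circ_hom f' g') (circ_hom f g).
Proof. exact: boqd_hom_eq. Qed.

Definition black_bifunctor : bifunctor BOQD :=
  @Functor (prod_cat BOQD BOQD) BOQD (fun X => black X.1 X.2)
    (fun X Y f => black_hom f.1 f.2)
    (fun X => black_hom1 X.1 X.2)
    (fun X Y Z g f => black_homM g.1 g.2 f.1 f.2).

Definition circ_bifunctor : bifunctor BOQD :=
  @Functor (prod_cat BOQD BOQD) BOQD (fun X => circ X.1 X.2)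
    (fun X Y f => circ_hom f.1 f.2)
    (fun X => circ_hom1 X.1 X.2)
    (fun X Y Z g f => circ_homM g.1 g.2 f.1 f.2).

End BoqdCategory.

(* Main.v *)
From HB Require Import structures.
Require Import Defs.
From mathcomp Require Import all_boot all_algebra all_fingroup.
From mathcomp Require Import classical_sets ring.

Set Implicit Arguments.
Unset Strict Implicit.
Unset Printing Implicit Defensive.

Import GRing.Theory.
Local Open Scope ring_scope.

(** Every structure map here is given by a formula on pure tensors or on pairs,
    so the coherence axioms are equalities of linear maps that are read off on
    generators.  The content is that the maps respect the quadratic relations.

    For the interchange law, write the relations of the two direct sums as
    R(A) + {A, A'} + R(A') and R(B) + {B, B'} + R(B'), and multiply them by
    [psi]: this gives nine kinds of products.  The projection kills a tensor as
    soon as one of its two factors lies in A' ⊗ B or A ⊗ B'.  In six of the nine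
    kinds every term has such a factor ([diag_proj_psi_mixl],
    [diag_proj_psi_mixr] and [T3_map_psi_comp] with a zero map).  The products of R(A) with R(B) and of
    R(A') with R(B') are sent to relations of the black products.  In a product
    of two mixed relations only the two terms pairing a with b and a' with b'
    survive, and the Koszul signs
        |a'||b| + |a||a'| + |b||b'| + |a||b'|  =  |a'||b| + |a⊗b||a'⊗b'|  (mod 2)
    make their sum a multiple of a mixed relation
    ([diag_proj_psi_mix_mix]); the parities of a ⊗ b and a' ⊗ b' agree because
    those of a, a' and of b, b' do.

    For the black product, [psi] is associative up to the associator
    ([T3_map_assoc_psi]), and multiplying by the relation of the unit is the
    inverse of the unitor ([T3_map_lunitL_inv]); so the relations correspond in
    both directions.  For the direct sum, the symmetric form of the mixed
    relations provides a braiding, and reversing the order of three summands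
    with it turns the associator into its inverse.

    The lax unit K -> K + K is the diagonal: the cross terms of the image of
    the unit relation are mixed relations between invariants of degree 0.  The
    colax unit 0 • 0 -> 0 is the zero map.

    All identities between maps on arity 3 components are tested on the
    monomials [tau i a b] with a and b homogeneous ([T3_ext]). *)

(** * Bilinear maps and tensor products *)

Section Bilinear.
Variables (K : fieldType) (U V W X : lmodType K).

Lemma bilin0l (f : U -> V -> W) v : bilinear_map f -> f 0 v = 0.
Proof. by move=> fB; rewrite -[0](scale0r 0) (bilinZl _ _ _ fB) scale0r. Qed.

Lemma bilin0r (f : U -> V -> W) u : bilinear_map f -> f u 0 = 0.
Proof. by move=> fB; rewrite -[X in f u X](scale0r 0) (bilinZr _ _ _ fB) scale0r. Qed.

Lemma tens_lift_bilinl (f : U -> V -> W -> X) :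
  (forall w, bilinear_map (fun u v => f u v w)) -> (forall u v, linear (f u v)) ->
  bilinear_map (fun x w => tens_lift (fun u v => f u v w) x).
Proof.
move=> fB fL; split=> [w|x c w w']; first exact: tens_lift_linear.
rewrite /tens_lift /eval_sum scaler_sumr -big_split.
by apply: eq_bigr => p _; rewrite fL.
Qed.

Lemma tens_lift_bilinr (f : W -> U -> V -> X) :
  (forall w, bilinear_map (f w)) -> (forall u v, linear (fun w => f w u v)) ->
  bilinear_map (fun w x => tens_lift (f w) x).
Proof.
move=> fB fL; split=> [x c w w'|w]; last exact: tens_lift_linear.
rewrite /tens_lift /eval_sum scaler_sumr -big_split.
by apply: eq_bigr => p _; rewrite (fL p.1 p.2 c w w').
Qed.

Lemma tensDl (u u' : U) (v : V) : (u + u') ⊗ v = u ⊗ v + u' ⊗ v.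
Proof. exact: (bilinDl _ _ _ (@tens_bilinear K U V)). Qed.

Lemma tensDr (u : U) (v v' : V) : u ⊗ (v + v') = u ⊗ v + u ⊗ v'.
Proof. exact: (bilinDr _ _ _ (@tens_bilinear K U V)). Qed.

Lemma tensZl c (u : U) (v : V) : (c *: u) ⊗ v = c *: (u ⊗ v).
Proof. exact: (bilinZl _ _ _ (@tens_bilinear K U V)). Qed.

Lemma tensZr c (u : U) (v : V) : u ⊗ (c *: v) = c *: (u ⊗ v).
Proof. exact: (bilinZr _ _ _ (@tens_bilinear K U V)). Qed.

(** Unlike in [span_map], the target is any subspace, for which no spanning set
    has to be given. *)
Lemma span_ind_linear (G : set U) (R : set W) (f : U -> W) :
  R 0 -> (forall c x y, R x -> R y -> R (c *: x + y)) -> linear f ->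
  (forall x, G x -> R (f x)) -> forall x, Defs.span G x -> R (f x).
Proof.
move=> R0 RL fL GR x; pose f' := mk_linear fL.
elim=> [|c g y Gg _ IH]; first by rewrite (linear0 f' : f 0 = 0).
by rewrite fL; apply: RL => //; apply: GR.
Qed.

End Bilinear.

(** * Monomials of arity 3 *)

Section Arity3Calculus.
Variable K : fieldType.
Implicit Types V W : s2mod K.

Lemma sub_S3D V (R : set (T3 V)) x y : sub_S3 R -> R x -> R y -> R (x + y).
Proof. by move=> Rs Rx Ry; rewrite -[x]scale1r; apply: sub_S3_linear. Qed.

Lemma sub_S3Z V (R : set (T3 V)) c x : sub_S3 R -> R x -> R (c *: x).
Proof.
by move=> Rs Rx; rewrite -[_ *: _]addr0; apply: sub_S3_linear => //; apply: sub_S3_0.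
Qed.

Lemma tau_bilinear V i : bilinear_map (@tau K V i).
Proof.
split=> [b c a a'|a c b b']; apply/ffunP => j; rewrite !ffunE;
  case: ifP => _; rewrite ?scaler0 ?addr0 //.
  by rewrite tensDl tensZl.
by rewrite tensDr tensZr.
Qed.

Lemma T3_ind V (P : T3 V -> Prop) :
  P 0 -> (forall x y, P x -> P y -> P (x + y)) ->
  (forall i p q a b, homogeneous p a -> homogeneous q b -> P (tau i a b)) ->
  forall t, P t.
Proof.
move=> P0 PD Pt t.
have -> : t = \sum_i [ffun j => if j == i then t i else 0].
  apply/ffunP => j; rewrite sum_ffunE (bigD1 j) //= ffunE eqxx big1 ?addr0 //.
  by move=> i ij; rewrite ffunE eq_sym (negbTE ij).
apply: (big_ind P) => // i _.
elim/tens_homog_ind: (t i) => [|x y hx hy|p q a b ap bq].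
- by rewrite (_ : finfun _ = 0) //; apply/ffunP => j; rewrite !ffunE if_same.
- rewrite (_ : finfun _ = [ffun j => if j == i then x else 0] +
      [ffun j => if j == i then y else 0]); first exact: PD.
  by apply/ffunP => j; rewrite !ffunE; case: ifP; rewrite ?addr0.
exact: Pt ap bq.
Qed.

Lemma T3_ext V (U : lmodType K) (f g : T3 V -> U) : linear f -> linear g ->
  (forall i p q a b, homogeneous p a -> homogeneous q b -> f (tau i a b) = g (tau i a b)) ->
  f =1 g.
Proof.
move=> fL gL fg; pose f' := mk_linear fL; pose g' := mk_linear gL.
elim/T3_ind => [|x y hx hy|i p q a b ap bq]; last exact: fg ap bq.
  by rewrite (linear0 f' : f 0 = 0) (linear0 g' : g 0 = 0).
by rewrite (linearD f' x y : f _ = _) (linearD g' x y : g _ = _) /= hx hy.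
Qed.

Lemma T3_act_tau V s i (a b : V) :
  T3_act s (tau i a b) = tau (s i) a (if odd_perm s then swap b else b).
Proof.
apply/ffunP => j; rewrite !ffunE /=.
have -> : ((s^-1)%g j == i) = (j == s i) by rewrite (canF_eq (permKV s)).
case: (odd_perm s); case: ifP => _ //; last exact: tens_map0.
by rewrite tens_mapE.
Qed.

Lemma psiDl V W (x x' : T3 V) (y : T3 W) : psi (x + x') y = psi x y + psi x' y.
Proof. exact: (bilinDl _ _ _ (psi_bilinear V W)). Qed.

Lemma psiDr V W (x : T3 V) (y y' : T3 W) : psi x (y + y') = psi x y + psi x y'.
Proof. exact: (bilinDr _ _ _ (psi_bilinear V W)). Qed.

Lemma psiZl V W c (x : T3 V) (y : T3 W) : psi (c *: x) y = c *: psi x y.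
Proof. exact: (bilinZl _ _ _ (psi_bilinear V W)). Qed.

Lemma psiZr V W c (x : T3 V) (y : T3 W) : psi x (c *: y) = c *: psi x y.
Proof. exact: (bilinZr _ _ _ (psi_bilinear V W)). Qed.

Lemma psi_linearl V W c (x x' : T3 V) (y : T3 W) :
  psi (c *: x + x') y = c *: psi x y + psi x' y.
Proof. by rewrite psiDl psiZl. Qed.

Lemma psi_linearr V W c (x : T3 V) (y y' : T3 W) :
  psi x (c *: y + y') = c *: psi x y + psi x y'.
Proof. by rewrite psiDr psiZr. Qed.

Lemma T3_map_psi_tau V W (U : s2mod K) (h : {linear tens_s2mod V W -> U})
    i j (a a' : V) (b b' : W) p q :
  homogeneous p a' -> homogeneous q b ->
  T3_map h (psi (tau i a a') (tau j b b')) =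
  if i == j then (-1) ^ (p * q) *: tau i (h (a ⊗ b)) (h (a' ⊗ b')) else 0.
Proof.
move=> ap bq; rewrite (psiE _ _ _ _ ap bq); case: ifP => _; last exact: T3_map0.
by rewrite T3_mapZ T3_map_tau.
Qed.

Lemma T3_map_psi_expand V W (U : s2mod K) (h : {linear tens_s2mod V W -> U})
    c d (x x' : T3 V) (y y' : T3 W) :
  T3_map h (psi (x + c *: x') (y + d *: y')) =
  (T3_map h (psi x y) + d *: T3_map h (psi x y')) +
  c *: (T3_map h (psi x' y) + d *: T3_map h (psi x' y')).
Proof.
have E z : T3_map h (psi z (y + d *: y')) = T3_map h (psi z y) + d *: T3_map h (psi z y').
  by rewrite psiDr psiZr T3_mapD T3_mapZ.
by rewrite psiDl psiZl T3_mapD T3_mapZ !E.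
Qed.

End Arity3Calculus.

(** * Mixed relations and the relations of a direct sum *)

Section SymTau.
Variable K : fieldType.
Implicit Types V W U : s2mod K.

Lemma signM_self (n : int) : ((-1 : K) ^ n) * (-1) ^ n = 1.
Proof. by rewrite -expfzMl mulrNN mulr1 exp1rz. Qed.

(** With x = (a, 0), y = (0, b) and n = |a||b| this is the mixed relation of a
    and b.  The exponent is a parameter so that no homogeneity is involved in
    the algebra of these elements. *)
Definition sym_tau V (i : 'I_3) (n : int) (x y : V) : T3 V :=
  tau i x y + (-1) ^ n *: tau i y x.

Lemma sym_tauC V i n (x y : V) : sym_tau i n y x = (-1) ^ n *: sym_tau i n x y.
Proof. by rewrite /sym_tau scalerDr scalerA signM_self scale1r addrC. Qed.

Lemma sym_tauDl V i n (x x' y : V) :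
  sym_tau i n (x + x') y = sym_tau i n x y + sym_tau i n x' y.
Proof.
have B := tau_bilinear V i.
by rewrite /sym_tau (bilinDl _ _ _ B) (bilinDr _ _ _ B) scalerDr addrACA.
Qed.

Lemma T3_map_sym_tau V W (f : {linear V -> W}) i n x y :
  T3_map f (sym_tau i n x y) = sym_tau i n (f x) (f y).
Proof. by rewrite T3_mapD T3_mapZ !T3_map_tau. Qed.

Definition same_parity V W (a : V) (b : W) : Prop :=
  (swap a = a /\ swap b = b) \/ (swap a = - a /\ swap b = - b).

Lemma same_parityC V W (a : V) (b : W) : same_parity a b -> same_parity b a.
Proof. by case=> -[? ?]; [left | right]. Qed.

Lemma same_parity_map V W V' W' (f : {linear V -> V'}) (g : {linear W -> W'}) a b :
  (forall v, f (swap v) = swap (f v)) -> (forall w, g (swap w) = swap (g w)) ->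
  same_parity a b -> same_parity (f a) (g b).
Proof.
move=> fs gs [] [ha hb]; [left | right]; split; rewrite -?fs -?gs ?ha ?hb ?linearN //.
Qed.

Lemma homog_map V W (f : {linear V -> W}) p a :
  (forall n v, f (gproj n v) = gproj n (f v)) -> homogeneous p a -> homogeneous p (f a).
Proof. by move=> fp ap; rewrite /homogeneous -fp ap. Qed.

Lemma homog_inl V W p (a : V) : homogeneous p a -> homogeneous p (dsum_inl V W a).
Proof. exact: homog_map (@dsum_inl_gproj K V W). Qed.

Lemma homog_inr V W p (b : W) : homogeneous p b -> homogeneous p (dsum_inr V W b).
Proof. exact: homog_map (@dsum_inr_gproj K V W). Qed.

Lemma homog_fst V W p (x : dsum_s2mod V W) : homogeneous p x -> homogeneous p x.1.
Proof. by rewrite /homogeneous => {2}<-. Qed.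

Lemma homog_snd V W p (x : dsum_s2mod V W) : homogeneous p x -> homogeneous p x.2.
Proof. by rewrite /homogeneous => {2}<-. Qed.

Lemma dsum_decomp V W (x : dsum_s2mod V W) :
  x = dsum_inl V W x.1 + dsum_inr V W x.2.
Proof. by case: x => v w; congr pair; rewrite /= ?addr0 ?add0r. Qed.

(** An odd permutation swaps the arguments of the inner operation, which
    multiplies both terms by the common parity sign c of a and b.  So S_3
    permutes, up to sign, the mixed relations of the three shapes. *)
Lemma T3_act_sym_tau V W s i n (a : V) (b : W) : same_parity a b ->
  exists2 c : K, c * c = 1 &
    T3_act s (sym_tau i n (dsum_inl V W a) (dsum_inr V W b)) =
    c *: sym_tau (s i) n (dsum_inl V W a) (dsum_inr V W b).
Proof.
have actZ c x : T3_act s (c *: x) = c *: T3_act s x :> T3 (dsum_s2mod V W).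
  exact: (linearZ_LR (mk_linear (@T3_act_linear K (dsum_s2mod V W) s))).
rewrite /sym_tau T3_actD actZ !T3_act_tau -dsum_inl_swap -dsum_inr_swap.
case: (odd_perm s); last by exists 1; rewrite ?mulr1 // scale1r.
case=> -[-> ->]; first by exists 1; rewrite ?mulr1 // scale1r.
exists (-1); first by rewrite mulrNN mulr1.
rewrite !linearN -!scaleN1r !(bilinZr _ _ _ (tau_bilinear _ _)).
by rewrite scalerDr !scalerA (mulrC (-1)).
Qed.

Lemma mix_sym_tau V W i p q (a : V) (b : W) :
  homogeneous p a -> homogeneous q b -> same_parity a b ->
  @mix_rels K V W (sym_tau i (p * q) (dsum_inl V W a) (dsum_inr V W b)).
Proof.
move=> ap bq ab; pose s := tperm (@ord_max 2) i.
have [c cc cE] := T3_act_sym_tau s ord_max (p * q) ab.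
rewrite -[sym_tau _ _ _ _]scale1r -cc -scalerA.
move: cE; rewrite tpermL => <-.
apply: (sub_S3Z _ (mix_rels_sub V W)); apply: span_gen.
by exists s => //; eexists; last reflexivity; exists p, q, a, b.
Qed.

(** With [mix_sym_tau], this replaces the generation as an S_3-module in
    [mix_rels] by a linear span. *)
Lemma mix_rels_ind V W U (R : set (T3 U)) (f : T3 (dsum_s2mod V W) -> T3 U) :
  sub_S3 R -> linear f ->
  (forall i p q a b, homogeneous p a -> homogeneous q b -> same_parity a b ->
     R (f (sym_tau i (p * q) (dsum_inl V W a) (dsum_inr V W b)))) ->
  forall m, @mix_rels K V W m -> R (f m).
Proof.
move=> Rs fL fR m.
apply: (span_ind_linear (sub_S3_0 Rs) _ fL) => [c x y|_ [s _ [t tG <-]]].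
  exact: sub_S3_linear.
case: tG => p [q [a [b [ap bq ab ->]]]].
have [c _ cE] := T3_act_sym_tau s ord_max (p * q) ab.
have fZ x : f (c *: x) = c *: f x by exact: (linearZ_LR (mk_linear fL)).
by move: cE; rewrite /sym_tau => ->; rewrite fZ; apply: sub_S3Z => //; apply: fR.
Qed.

(** The map f is any linear map rather than some [T3_map h], so that products
    with a fixed element, r |-> T3_map h (psi r s), are covered. *)
Lemma circ_rels_ind (A B : boqd K) U (R : set (T3 U))
    (f : T3 (dsum_s2mod A B) -> T3 U) :
  sub_S3 R -> linear f ->
  (forall r, rels A r -> R (f (T3_map (dsum_inl A B) r))) ->
  (forall i p q (a : A) (b : B), homogeneous p a -> homogeneous q b -> same_parity a b ->
     R (f (sym_tau i (p * q) (dsum_inl A B a) (dsum_inr A B b)))) ->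
  (forall s, rels B s -> R (f (T3_map (dsum_inr A B) s))) ->
  forall t, rels (circ A B) t -> R (f t).
Proof.
move=> Rs fL fl fm fr _ [r [m [s [Ar Mm Bs ->]]]].
have fD x y : f (x + y) = f x + f y by exact: (linearD (mk_linear fL)).
rewrite !fD; apply: (sub_S3D Rs); last exact: fr.
by apply: (sub_S3D Rs); [apply: fl | apply: (mix_rels_ind Rs fL fm)].
Qed.

Lemma circ_rels_inl (A B : boqd K) r :
  rels A r -> rels (circ A B) (T3_map (dsum_inl A B) r).
Proof.
move=> Ar; exists r, 0, 0; split=> //; try exact: sub_S3_0 (rels_sub _).
  exact: sub_S3_0 (mix_rels_sub _ _).
by rewrite T3_map0 !addr0.
Qed.

Lemma circ_rels_inr (A B : boqd K) s :
  rels B s -> rels (circ A B) (T3_map (dsum_inr A B) s).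
Proof.
move=> Bs; exists 0, 0, s; split=> //; try exact: sub_S3_0 (rels_sub _).
  exact: sub_S3_0 (mix_rels_sub _ _).
by rewrite T3_map0 !add0r.
Qed.

Lemma circ_rels_mix (A B : boqd K) i p q (a : A) (b : B) :
  homogeneous p a -> homogeneous q b -> same_parity a b ->
  rels (circ A B) (sym_tau i (p * q) (dsum_inl A B a) (dsum_inr A B b)).
Proof.
move=> ap bq ab; exists 0, (sym_tau i (p * q) (dsum_inl A B a) (dsum_inr A B b)), 0.
split; try exact: sub_S3_0 (rels_sub _); first exact: mix_sym_tau.
by rewrite !T3_map0 add0r addr0.
Qed.

End SymTau.

(** * The black product as a monoidal structure *)

Section BlackMonoidal.
Variable K : fieldType.

Section TensorAssociator.
Variables U V W : lmodType K.

Lemma tens_assoc_bilinear :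
  bilinear_map (fun (x : tensor U V) (w : W) =>
    tens_lift (fun (u : U) (v : V) => u ⊗ (v ⊗ w)) x).
Proof.
apply: (@tens_lift_bilinl _ _ _ _ _ (fun u v w => u ⊗ (v ⊗ w))) => [w|u v c w w'].
  by split=> [v c u u'|u c v v']; rewrite !(tensDl, tensZl, tensDr, tensZr).
by rewrite !(tensDr, tensZr).
Qed.

Lemma tens_unassoc_bilinear :
  bilinear_map (fun (u : U) (y : tensor V W) =>
    tens_lift (fun (v : V) (w : W) => (u ⊗ v) ⊗ w) y).
Proof.
apply: (@tens_lift_bilinr _ _ _ _ _ (fun u v w => (u ⊗ v) ⊗ w)) => [u|v w c u u'].
  by split=> [w c v v'|v c w w']; rewrite !(tensDl, tensZl, tensDr, tensZr).
by rewrite !(tensDl, tensZl).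
Qed.

Definition tens_assoc (x : tensor (tensor U V) W) : tensor U (tensor V W) :=
  tens_lift (fun (x : tensor U V) (w : W) =>
    tens_lift (fun (u : U) (v : V) => u ⊗ (v ⊗ w)) x) x.

Definition tens_unassoc (x : tensor U (tensor V W)) : tensor (tensor U V) W :=
  tens_lift (fun (u : U) (y : tensor V W) =>
    tens_lift (fun (v : V) (w : W) => (u ⊗ v) ⊗ w) y) x.

HB.instance Definition _ := GRing.isLinear.Build K (tensor (tensor U V) W)
  (tensor U (tensor V W)) *:%R tens_assoc (tens_lift_linear tens_assoc_bilinear).

HB.instance Definition _ := GRing.isLinear.Build K (tensor U (tensor V W))
  (tensor (tensor U V) W) *:%R tens_unassoc (tens_lift_linear tens_unassoc_bilinear).

Lemma tens_assocE u v w : tens_assoc ((u ⊗ v) ⊗ w) = u ⊗ (v ⊗ w).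
Proof.
rewrite /tens_assoc tens_liftE; last exact: tens_assoc_bilinear.
rewrite tens_liftE //.
by split=> [? c ? ?|? c ? ?]; rewrite !(tensDl, tensZl, tensDr, tensZr).
Qed.

Lemma tens_unassocE u v w : tens_unassoc (u ⊗ (v ⊗ w)) = (u ⊗ v) ⊗ w.
Proof.
rewrite /tens_unassoc tens_liftE; last exact: tens_unassoc_bilinear.
rewrite tens_liftE //.
by split=> [? c ? ?|? c ? ?]; rewrite !(tensDl, tensZl, tensDr, tensZr).
Qed.

End TensorAssociator.

Lemma tens3_homog_uniq (U V W : s2mod K) (X : lmodType K)
    (f g : {linear tensor (tens_s2mod U V) W -> X}) :
  (forall p q r u v w, homogeneous p u -> homogeneous q v -> homogeneous r w ->
     f ((u ⊗ v) ⊗ w) = g ((u ⊗ v) ⊗ w)) -> f =1 g.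
Proof.
move=> fg; elim/tens_homog_ind => [|x y hx hy|_ r x w _ wr].
- by rewrite !linear0.
- by rewrite !linearD hx hy.
elim/tens_homog_ind: x => [|x y hx hy|p q u v up vq]; last exact: fg up vq wr.
  by rewrite tens0l !linear0.
by rewrite tensDl !linearD hx hy.
Qed.

Lemma tens3_uniq (U V W X : lmodType K) (f g : {linear tensor (tensor U V) W -> X}) :
  (forall u v w, f ((u ⊗ v) ⊗ w) = g ((u ⊗ v) ⊗ w)) -> f =1 g.
Proof.
move=> fg; apply: tens_lift_uniq => x w; elim/tens_ind: x => [|x y hx hy|//].
  by rewrite tens0l !linear0.
by rewrite tensDl !linearD hx hy.
Qed.

Lemma tens3r_uniq (U V W X : lmodType K) (f g : {linear tensor U (tensor V W) -> X}) :
  (forall u v w, f (u ⊗ (v ⊗ w)) = g (u ⊗ (v ⊗ w))) -> f =1 g.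
Proof.
move=> fg; apply: tens_lift_uniq => u x; elim/tens_ind: x => [|x y hx hy|//].
  by rewrite tens0r !linear0.
by rewrite tensDr !linearD hx hy.
Qed.

Lemma tens4_uniq (U V W Z X : lmodType K)
    (f g : {linear tensor (tensor (tensor U V) W) Z -> X}) :
  (forall u v w z, f (((u ⊗ v) ⊗ w) ⊗ z) = g (((u ⊗ v) ⊗ w) ⊗ z)) -> f =1 g.
Proof.
move=> fg; apply: tens3_uniq => x w z; elim/tens_ind: x => [|x y hx hy|//].
  by rewrite !tens0l !linear0.
by rewrite !tensDl !linearD hx hy.
Qed.

Section Associator.
Variables U V W : s2mod K.

Definition assocL : {linear tens_s2mod (tens_s2mod U V) W -> tens_s2mod U (tens_s2mod V W)} :=
  @tens_assoc U V W.
Definition unassocL : {linear tens_s2mod U (tens_s2mod V W) -> tens_s2mod (tens_s2mod U V) W} :=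
  @tens_unassoc U V W.

Lemma assocLK : cancel assocL unassocL.
Proof.
apply: (tens3_uniq (f := unassocL \o assocL) (g := idfun)) => u v w.
by rewrite /= tens_assocE tens_unassocE.
Qed.

Lemma unassocLK : cancel unassocL assocL.
Proof.
apply: (tens3r_uniq (f := assocL \o unassocL) (g := idfun)) => u v w.
by rewrite /= tens_unassocE tens_assocE.
Qed.

Lemma assocL_swap x : assocL (swap x) = swap (assocL x).
Proof.
apply: (tens3_uniq (f := assocL \o swap) (g := swap \o assocL)) => u v w.
by rewrite /= !(tens_assocE, tens_mapE) /= !tens_mapE tens_assocE.
Qed.

Lemma assocL_gproj n x : assocL (gproj n x) = gproj n (assocL x).
Proof.
apply: (tens3_homog_uniq (f := assocL \o gproj n) (g := gproj n \o assocL)) => p q r u v w up vq wr.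
have h1 := homog_tens (homog_tens up vq) wr.
have h2 := homog_tens up (homog_tens vq wr).
rewrite -[LHS]/(assocL (@gproj K (tens_s2mod (tens_s2mod U V) W) n (u ⊗ v ⊗ w))).
rewrite -[RHS]/(gproj n (assocL (u ⊗ v ⊗ w))).
rewrite (gproj_homog n h1) [assocL (u ⊗ v ⊗ w)]tens_assocE (gproj_homog n h2) addrA.
by case: ifP => _; rewrite ?linear0 //; apply: tens_assocE.
Qed.

(** Both sides carry the Koszul sign of
    |a'||b| + |a'||c| + |b'||c| on monomials of a common shape. *)
Lemma T3_map_assoc_psi (r : T3 U) (s : T3 V) (t : T3 W) :
  T3_map assocL (psi (psi r s) t) = psi r (psi s t).
Proof.
move: r; apply: T3_ext => [c x y|c x y|i p p' a a' ap ap'].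
- by rewrite !(psi_linearl, T3_map_linear).
- by rewrite !psi_linearl.
move: s; apply: T3_ext => [c x y|c x y|j q q' b b' bq bq'].
- by rewrite !(psi_linearl, psi_linearr, T3_map_linear).
- by rewrite !(psi_linearl, psi_linearr).
move: t; apply: T3_ext => [c x y|c x y|k m m' d d' dm dm'].
- by rewrite !(psi_linearr, T3_map_linear).
- by rewrite !psi_linearr.
rewrite (psiE _ _ _ _ ap' bq) (psiE _ _ _ _ bq' dm).
case: (i =P j) => [<-|ij]; last first.
  rewrite (bilin0l _ (psi_bilinear _ _)) T3_map0; case: ifP => _.
    rewrite psiZr (psiE _ _ _ _ ap' (homog_tens bq dm)).
    by case: eqP => // _; rewrite scaler0.
  by rewrite (bilin0r _ (psi_bilinear _ _)).
case: (i =P k) => [<-|ik]; last first.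
  rewrite (bilin0r _ (psi_bilinear _ _)) psiZl (psiE _ _ _ _ (homog_tens ap' bq') dm).
  by case: eqP => // _; rewrite scaler0 T3_map0.
rewrite psiZl psiZr (psiE _ _ _ _ (homog_tens ap' bq') dm).
rewrite (psiE _ _ _ _ ap' (homog_tens bq dm)) eqxx !T3_mapZ T3_map_tau.
rewrite [assocL _]tens_assocE [assocL _]tens_assocE !scalerA; congr (_ *: _).
by rewrite -!expfzDr ?oppr_eq0 ?oner_eq0 //; congr (_ ^ _); ring.
Qed.

End Associator.

Lemma black_rels_ind (A B : boqd K) (U : s2mod K) (R : set (T3 U))
    (f : T3 (tens_s2mod A B) -> T3 U) :
  sub_S3 R -> linear f ->
  (forall r s, rels A r -> rels B s -> R (f (psi r s))) ->
  forall t, rels (black A B) t -> R (f t).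
Proof.
move=> Rs fL fR t.
apply: (span_ind_linear (sub_S3_0 Rs) _ fL) => [c x y|_ [r Ar [s Bs <-]]].
  exact: sub_S3_linear.
exact: fR.
Qed.

Lemma black_unit_rels_ind (U : s2mod K) (R : set (T3 U))
    (f : T3 (trivial_s2mod K) -> T3 U) :
  sub_S3 R -> linear f -> R (f (\sum_(i < 3) tau i (1 : K^o) (1 : K^o))) ->
  forall t, rels (black_unit K) t -> R (f t).
Proof.
move=> Rs fL fR t.
apply: (span_ind_linear (sub_S3_0 Rs) _ fL) => [c x y|_ -> //].
exact: sub_S3_linear.
Qed.

Lemma black_rels_psi (A B : boqd K) r s :
  rels A r -> rels B s -> rels (black A B) (psi r s).
Proof. by move=> Ar Bs; apply: span_gen; exists r => //; exists s. Qed.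

Section BlackAssoc.
Variables A B C : boqd K.

Lemma assocL_rels t :
  rels (black (black A B) C) t -> rels (black A (black B C)) (T3_map (assocL A B C) t).
Proof.
have Rs := rels_sub (black A (black B C)).
move: t; apply: (black_rels_ind Rs (@T3_map_linear K _ _ _)) => x t Ax Ct.
move: x Ax; apply: (black_rels_ind (f := fun x => T3_map _ (psi x t)) Rs).
  by move=> c x y; rewrite psi_linearl T3_map_linear.
move=> r s Ar Bs; rewrite T3_map_assoc_psi.
by do 2?apply: black_rels_psi.
Qed.

Lemma unassocL_rels t :
  rels (black A (black B C)) t -> rels (black (black A B) C) (T3_map (unassocL A B C) t).
Proof.
have Rs := rels_sub (black (black A B) C).
move: t; apply: (black_rels_ind Rs (@T3_map_linear K _ _ _)) => r x Ar BCx.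
move: x BCx; apply: (black_rels_ind (f := fun x => T3_map _ (psi r x)) Rs).
  by move=> c x y; rewrite psi_linearr T3_map_linear.
move=> s t Bs Ct; rewrite -T3_map_assoc_psi (T3_map_comp (h := idfun)); last exact: assocLK.
by rewrite T3_map_id //; do 2?apply: black_rels_psi.
Qed.

Lemma unassocL_swap x : unassocL A B C (swap x) = swap (unassocL A B C x).
Proof. by apply: (can_inj (@assocLK A B C)); rewrite assocL_swap !unassocLK. Qed.

Lemma unassocL_gproj n x : unassocL A B C (gproj n x) = gproj n (unassocL A B C x).
Proof. by apply: (can_inj (@assocLK A B C)); rewrite assocL_gproj !unassocLK. Qed.

Definition black_assoc : boqd_hom (black (black A B) C) (black A (black B C)) :=
  @BoqdHom K (black (black A B) C) (black A (black B C)) (assocL A B C)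
    (@assocL_gproj A B C) (@assocL_swap A B C) assocL_rels.

Definition black_unassoc : boqd_hom (black A (black B C)) (black (black A B) C) :=
  @BoqdHom K (black A (black B C)) (black (black A B) C) (unassocL A B C)
    unassocL_gproj unassocL_swap unassocL_rels.

End BlackAssoc.

Section BlackUnit.
Variable V : s2mod K.

Lemma scale_bilinear : bilinear_map (fun (k : K^o) (v : V) => k *: v).
Proof.
by split=> [v c k k'|k c v v']; rewrite ?scalerDl ?scalerDr -?scalerA // !scalerA mulrC.
Qed.

Definition tens_lunit (x : tensor K^o V) : V := tens_lift (fun (k : K^o) (v : V) => k *: v) x.
HB.instance Definition _ := GRing.isLinear.Build K (tensor K^o V)
  V *:%R tens_lunit (tens_lift_linear scale_bilinear).

Lemma scale_bilinear_flip : bilinear_map (fun (v : V) (k : K^o) => k *: v).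
Proof. by have [l r] := scale_bilinear. Qed.

Definition tens_runit (x : tensor V K^o) : V := tens_lift (fun (v : V) (k : K^o) => k *: v) x.
HB.instance Definition _ := GRing.isLinear.Build K (tensor V K^o)
  V *:%R tens_runit (tens_lift_linear scale_bilinear_flip).

Lemma tens_lunitE k v : tens_lunit (k ⊗ v) = k *: v.
Proof. by rewrite /tens_lunit tens_liftE //; apply: scale_bilinear. Qed.

Lemma tens_runitE v k : tens_runit (v ⊗ k) = k *: v.
Proof. by rewrite /tens_runit tens_liftE //; apply: scale_bilinear_flip. Qed.

Let I := trivial_s2mod K.

Definition lunitL : {linear tens_s2mod I V -> V} := tens_lunit.
Definition runitL : {linear tens_s2mod V I -> V} := tens_runit.

Lemma lunitL_inv_linear : linear (fun v : V => ((1 : K^o) ⊗ v) : tens_s2mod I V).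
Proof. by move=> c v v'; rewrite tensDr tensZr. Qed.

Lemma runitL_inv_linear : linear (fun v : V => (v ⊗ (1 : K^o)) : tens_s2mod V I).
Proof. by move=> c v v'; rewrite tensDl tensZl. Qed.

Definition lunitL_inv : {linear V -> tens_s2mod I V} := mk_linear lunitL_inv_linear.
Definition runitL_inv : {linear V -> tens_s2mod V I} := mk_linear runitL_inv_linear.

Lemma lunitL_invK : cancel lunitL_inv lunitL.
Proof. by move=> v; rewrite /= tens_lunitE scale1r. Qed.

Lemma runitL_invK : cancel runitL_inv runitL.
Proof. by move=> v; rewrite /= tens_runitE scale1r. Qed.

Lemma lunitLK : cancel lunitL lunitL_inv.
Proof.
apply: (tens_lift_uniq (f := lunitL_inv \o lunitL) (g := idfun)) => k v.
by rewrite /= tens_lunitE tensZr -tensZl [_ *: _]mulr1.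
Qed.

Lemma runitLK : cancel runitL runitL_inv.
Proof.
apply: (tens_lift_uniq (f := runitL_inv \o runitL) (g := idfun)) => v k.
by rewrite /= tens_runitE tensZl -tensZr [_ *: _]mulr1.
Qed.

Lemma homog_1 : homogeneous 0 (1 : I).
Proof. by []. Qed.

Lemma lunitL_inv_swap v : lunitL_inv (swap v) = swap (lunitL_inv v).
Proof. by rewrite /= tens_mapE. Qed.

Lemma runitL_inv_swap v : runitL_inv (swap v) = swap (runitL_inv v).
Proof. by rewrite /= tens_mapE. Qed.

Lemma lunitL_inv_gproj n v : lunitL_inv (gproj n v) = gproj n (lunitL_inv v).
Proof.
have [s _ ->] := gproj_sum v; rewrite !linear_sum; apply: eq_bigr => m _.
rewrite gproj_orth (gproj_homog n (homog_tens homog_1 (homog_gproj m v))) add0r.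
by case: ifP => // _; rewrite linear0.
Qed.

Lemma runitL_inv_gproj n v : runitL_inv (gproj n v) = gproj n (runitL_inv v).
Proof.
have [s _ ->] := gproj_sum v; rewrite !linear_sum; apply: eq_bigr => m _.
rewrite gproj_orth (gproj_homog n (homog_tens (homog_gproj m v) homog_1)) addr0.
by case: ifP => // _; rewrite linear0.
Qed.

(** The unit relation has a monomial of each shape, with coefficient 1 and
    entries of degree 0, so [psi] with it selects each shape once and creates
    no sign. *)
Lemma T3_map_lunitL_inv r :
  T3_map lunitL_inv r = psi (\sum_(i < 3) tau i (1 : K^o) (1 : K^o) : T3 I) r.
Proof.
move: r; apply: T3_ext => [c x y|c x y|j p q a b ap bq].
- exact: T3_map_linear.
- exact: psi_linearr.
apply/ffunP => k; rewrite T3_map_tau !ffunE sum_tau.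
case: ifP => _; last by rewrite koszul_mid0r.
by rewrite (koszul_midE _ _ homog_1 ap) mul0r expr0z scale1r.
Qed.

Lemma T3_map_runitL_inv r :
  T3_map runitL_inv r = psi r (\sum_(i < 3) tau i (1 : K^o) (1 : K^o) : T3 I).
Proof.
move: r; apply: T3_ext => [c x y|c x y|j p q a b ap bq].
- exact: T3_map_linear.
- exact: psi_linearl.
apply/ffunP => k; rewrite T3_map_tau !ffunE sum_tau.
case: ifP => _; last by rewrite koszul_mid0l.
by rewrite (koszul_midE _ _ bq homog_1) mulr0 expr0z scale1r.
Qed.

Lemma lunitL_swap x : lunitL (swap x) = swap (lunitL x).
Proof. by apply: (can_inj lunitL_invK); rewrite lunitL_inv_swap !lunitLK. Qed.

Lemma lunitL_gproj n x : lunitL (gproj n x) = gproj n (lunitL x).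
Proof. by apply: (can_inj lunitL_invK); rewrite lunitL_inv_gproj !lunitLK. Qed.

Lemma runitL_swap x : runitL (swap x) = swap (runitL x).
Proof. by apply: (can_inj runitL_invK); rewrite runitL_inv_swap !runitLK. Qed.

Lemma runitL_gproj n x : runitL (gproj n x) = gproj n (runitL x).
Proof. by apply: (can_inj runitL_invK); rewrite runitL_inv_gproj !runitLK. Qed.

End BlackUnit.

Section BlackUnitHoms.
Variable A : boqd K.
Let I := black_unit K.

Lemma lunitL_inv_rels r : rels A r -> rels (black I A) (T3_map (lunitL_inv A) r).
Proof.
move=> Ar; rewrite T3_map_lunitL_inv.
by apply: black_rels_psi => //; apply: span_gen.
Qed.

Lemma runitL_inv_rels r : rels A r -> rels (black A I) (T3_map (runitL_inv A) r).
Proof.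
move=> Ar; rewrite T3_map_runitL_inv.
by apply: black_rels_psi => //; apply: span_gen.
Qed.

Lemma lunitL_rels t : rels (black I A) t -> rels A (T3_map (lunitL A) t).
Proof.
have As := rels_sub A.
move: t; apply: (black_rels_ind As (@T3_map_linear K _ _ _)) => u r Iu Ar.
move: u Iu; apply: (black_unit_rels_ind (f := fun u => T3_map _ (psi u r)) As).
  by move=> c x y; rewrite psi_linearl T3_map_linear.
rewrite -T3_map_lunitL_inv (T3_map_comp (h := idfun)) ?T3_map_id //.
exact: lunitL_invK.
Qed.

Lemma runitL_rels t : rels (black A I) t -> rels A (T3_map (runitL A) t).
Proof.
have As := rels_sub A.
move: t; apply: (black_rels_ind As (@T3_map_linear K _ _ _)) => r u Ar Iu.
move: u Iu; apply: (black_unit_rels_ind (f := fun u => T3_map _ (psi r u)) As).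
  by move=> c x y; rewrite psi_linearr T3_map_linear.
rewrite -T3_map_runitL_inv (T3_map_comp (h := idfun)) ?T3_map_id //.
exact: runitL_invK.
Qed.

Definition black_lunit : boqd_hom (black I A) A :=
  @BoqdHom K (black I A) A (lunitL A) (@lunitL_gproj A) (@lunitL_swap A) lunitL_rels.
Definition black_lunit_inv : boqd_hom A (black I A) :=
  @BoqdHom K A (black I A) (lunitL_inv A) (@lunitL_inv_gproj A) (@lunitL_inv_swap A)
    lunitL_inv_rels.
Definition black_runit : boqd_hom (black A I) A :=
  @BoqdHom K (black A I) A (runitL A) (@runitL_gproj A) (@runitL_swap A) runitL_rels.
Definition black_runit_inv : boqd_hom A (black A I) :=
  @BoqdHom K A (black A I) (runitL_inv A) (@runitL_inv_gproj A) (@runitL_inv_swap A)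
    runitL_inv_rels.

End BlackUnitHoms.


Lemma black_hom_ext (A B C : boqd K) (f g : boqd_hom (black A B) C) :
  (forall a b, f (a ⊗ b) = g (a ⊗ b)) -> f = g.
Proof. by move=> fg; apply/boqd_hom_eq/tens_lift_uniq. Qed.

Lemma black3_hom_ext (A B C D : boqd K) (f g : boqd_hom (black (black A B) C) D) :
  (forall a b c, f ((a ⊗ b) ⊗ c) = g ((a ⊗ b) ⊗ c)) -> f = g.
Proof. by move=> fg; apply/boqd_hom_eq/tens3_uniq. Qed.

Lemma black4_hom_ext (A B C D E : boqd K)
    (f g : boqd_hom (black (black (black A B) C) D) E) :
  (forall a b c d, f (((a ⊗ b) ⊗ c) ⊗ d) = g (((a ⊗ b) ⊗ c) ⊗ d)) -> f = g.
Proof. by move=> fg; apply/boqd_hom_eq/tens4_uniq. Qed.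

Definition tensE := (tens_mapE, tens_assocE, tens_lunitE, tens_runitE).

Definition black_monoidal : monoidal (black_bifunctor K) (black_unit K).
Proof.
refine (@Monoidal (BOQD K) (black_bifunctor K) (black_unit K)
  black_assoc black_lunit black_runit _ _ _ _ _ _ _ _).
- move=> A B C; exists (black_unassoc A B C).
  by split; apply: boqd_hom_eq; [apply: assocLK | apply: unassocLK].
- move=> A; exists (black_lunit_inv A).
  by split; apply: boqd_hom_eq; [apply: lunitLK | apply: lunitL_invK].
- move=> A; exists (black_runit_inv A).
  by split; apply: boqd_hom_eq; [apply: runitLK | apply: runitL_invK].
- move=> A B C A' B' C' f g h; apply: black3_hom_ext => a b c.
  by rewrite /= !tensE /= !tensE.
- by move=> A B f; apply: black_hom_ext => k a; rewrite /= !tensE linearZ.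
- by move=> A B f; apply: black_hom_ext => a k; rewrite /= !tensE linearZ.
- move=> A B C D; apply: black4_hom_ext => a b c d.
  by rewrite /= !tensE /= (tens_assocE a b c) !tensE /= !tensE.
move=> A B; apply: black3_hom_ext => a k b.
by rewrite /= !tensE /= !tensE tensZl tensZr.
Defined.

End BlackMonoidal.

(** * The direct sum as a monoidal structure *)

Section CircMonoidal.
Variable K : fieldType.
Implicit Types A B C : boqd K.

Section Braid.
Variables A B : boqd K.

Lemma braid_linear : linear (fun x : circ A B => (x.2, x.1) : circ B A).
Proof. by []. Qed.

Definition braidL : {linear circ A B -> circ B A} := mk_linear braid_linear.

Lemma braidL_rels t : rels (circ A B) t -> rels (circ B A) (T3_map braidL t).
Proof.
have Rs := rels_sub (circ B A).
move: t; apply: (circ_rels_ind Rs (@T3_map_linear K _ _ _)).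
- move=> r Ar; rewrite (T3_map_comp (h := dsum_inr B A)) //.
  exact: circ_rels_inr.
- move=> i p q a b ap bq ab; rewrite T3_map_sym_tau.
  rewrite (_ : sym_tau _ _ _ _ = sym_tau i (p * q) (dsum_inr B A a) (dsum_inl B A b)) //.
  rewrite sym_tauC mulrC; apply: (sub_S3Z _ Rs).
  by apply: circ_rels_mix => //; apply: same_parityC.
- move=> s Bs; rewrite (T3_map_comp (h := dsum_inl B A)) //.
  exact: circ_rels_inl.
Qed.

Definition circ_braid : boqd_hom (circ A B) (circ B A) :=
  @BoqdHom K (circ A B) (circ B A) braidL (fun _ _ => erefl) (fun _ => erefl) braidL_rels.

End Braid.

Section Assoc.
Variables A B C : boqd K.

Lemma circ_assoc_linear :
  linear (fun x : circ (circ A B) C => (x.1.1, (x.1.2, x.2)) : circ A (circ B C)).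
Proof. by []. Qed.

Definition circ_assocL : {linear circ (circ A B) C -> circ A (circ B C)} :=
  mk_linear circ_assoc_linear.

Lemma circ_assocL_rels t :
  rels (circ (circ A B) C) t -> rels (circ A (circ B C)) (T3_map circ_assocL t).
Proof.
have Rs := rels_sub (circ A (circ B C)).
pose j1 := dsum_inl (circ A B) C; pose j2 := dsum_inr (circ A B) C.
pose iA := dsum_inl A (circ B C); pose iBC := dsum_inr A (circ B C).
pose jA : {linear A -> circ (circ A B) C} := j1 \o dsum_inl A B.
pose jB : {linear B -> circ (circ A B) C} := j1 \o dsum_inr A B.
move: t; apply: (circ_rels_ind Rs (@T3_map_linear K _ _ _)).
- apply: (circ_rels_ind (f := fun r => T3_map circ_assocL (T3_map j1 r)) Rs).
  + by move=> c x y; rewrite !T3_map_linear.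
  + move=> r Ar; rewrite (T3_map_comp (h := jA)) // (T3_map_comp (h := iA)) //.
    exact: circ_rels_inl.
  + move=> i p q a b ap bq ab; rewrite !T3_map_sym_tau.
    apply: (@circ_rels_mix K A (circ B C) i p q a (dsum_inl B C b)) => //.
      exact: homog_inl.
    exact: (same_parity_map (f := idfun) (fun=> erefl) (@dsum_inl_swap K B C) ab).
  + move=> s Bs; rewrite (T3_map_comp (h := jB)) //.
    rewrite (T3_map_comp (h := iBC \o dsum_inl B C)) //.
    rewrite -(T3_map_comp (f := dsum_inl B C) (g := iBC)) //.
    by do 2!(apply: circ_rels_inr || apply: circ_rels_inl).
- (* x = (a, b) is a sum of two elements of the same degree and parity, which
     give a mixed relation of A with C and one inside B + C. *)
  move=> i p q x c xp cq xc; rewrite T3_map_sym_tau.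
  have [xl xr] : same_parity x.1 c /\ same_parity x.2 c.
    by case: xc => -[xE cE]; split; [left|left|right|right]; split=> //;
      first [exact: (congr1 fst xE) | exact: (congr1 snd xE)].
  rewrite (_ : circ_assocL _ = iA x.1 + iBC (dsum_inl B C x.2)); last first.
    by rewrite [LHS]dsum_decomp.
  rewrite sym_tauDl; apply: (sub_S3D Rs).
    apply: (@circ_rels_mix K A (circ B C) i p q x.1 (dsum_inr B C c)).
    + exact: homog_fst.
    + exact: homog_inr.
    exact: (same_parity_map (f := idfun) (fun=> erefl) (@dsum_inr_swap K B C) xl).
  rewrite -[circ_assocL _]/(iBC (dsum_inr B C c)) -T3_map_sym_tau.
  apply: circ_rels_inr; apply: circ_rels_mix => //; exact: homog_snd.
move=> s Cs; rewrite (T3_map_comp (h := iBC \o dsum_inr B C)) //.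
rewrite -(T3_map_comp (f := dsum_inr B C) (g := iBC)) //.
by do 2!apply: circ_rels_inr.
Qed.

Definition circ_assoc : boqd_hom (circ (circ A B) C) (circ A (circ B C)) :=
  @BoqdHom K (circ (circ A B) C) (circ A (circ B C)) circ_assocL
    (fun _ _ => erefl) (fun _ => erefl) circ_assocL_rels.

End Assoc.

(** Reversing the order of the three summands turns A + (B + C) into
    (C + B) + A, where the associator applies. *)
Definition circ_unassoc A B C : boqd_hom (circ A (circ B C)) (circ (circ A B) C) :=
  boqd_comp (circ_hom (circ_braid B A) (boqd_id C))
    (boqd_comp (circ_braid C (circ B A))
      (boqd_comp (circ_assoc C B A)
        (boqd_comp (circ_hom (circ_braid B C) (boqd_id A)) (circ_braid A (circ B C))))).

Section Unit.
Variable A : boqd K.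
Let O := circ_unit K.

Lemma circ_unit0 (z : O) : z = 0.
Proof. exact: thinmx0. Qed.

Lemma circ_lunit_linear : linear (fun x : circ O A => x.2).
Proof. by []. Qed.

Definition circ_lunitL : {linear circ O A -> A} := mk_linear circ_lunit_linear.

Lemma circ_lunitL_rels t : rels (circ O A) t -> rels A (T3_map circ_lunitL t).
Proof.
have Rs := rels_sub A.
move: t; apply: (circ_rels_ind Rs (@T3_map_linear K _ _ _)).
- by move=> _ ->; rewrite !T3_map0; apply: sub_S3_0.
- move=> i p q z a _ _ _; rewrite (circ_unit0 z) linear0 /sym_tau.
  rewrite (bilin0l _ (tau_bilinear _ _)) (bilin0r _ (tau_bilinear _ _)).
  by rewrite scaler0 addr0 T3_map0; apply: sub_S3_0.
by move=> s As; rewrite (T3_map_comp (h := idfun)) // T3_map_id.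
Qed.

Definition circ_lunit : boqd_hom (circ O A) A :=
  @BoqdHom K (circ O A) A circ_lunitL (fun _ _ => erefl) (fun _ => erefl)
    circ_lunitL_rels.

Definition circ_lunit_inv : boqd_hom A (circ O A) :=
  @BoqdHom K A (circ O A) (dsum_inr O A) (@dsum_inr_gproj K O A) (@dsum_inr_swap K O A)
    (@circ_rels_inr K O A).

Definition circ_runit : boqd_hom (circ A O) A := boqd_comp circ_lunit (circ_braid A O).
Definition circ_runit_inv : boqd_hom A (circ A O) :=
  boqd_comp (circ_braid O A) circ_lunit_inv.

End Unit.

Definition circ_monoidal : monoidal (circ_bifunctor K) (circ_unit K).
Proof.
refine (@Monoidal (BOQD K) (circ_bifunctor K) (circ_unit K)
  circ_assoc circ_lunit circ_runit _ _ _ _ _ _ _ _).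
- move=> A B C; exists (circ_unassoc A B C).
  by split; apply: boqd_hom_eq; [case=> -[a b] c | case=> a [b c]].
- move=> A; exists (circ_lunit_inv A).
  by split; apply: boqd_hom_eq => // -[z a]; rewrite (circ_unit0 z).
- move=> A; exists (circ_runit_inv A).
  by split; apply: boqd_hom_eq => // -[a z]; rewrite (circ_unit0 z).
- by move=> A B C A' B' C' f g h; apply: boqd_hom_eq.
- by move=> A B f; apply: boqd_hom_eq.
- by move=> A B f; apply: boqd_hom_eq.
- by move=> A B C D; apply: boqd_hom_eq.
by move=> A B; apply: boqd_hom_eq.
Defined.

End CircMonoidal.

(** * The interchange law *)

Section Interchange.
Variable K : fieldType.

Lemma zero_linear (U X : lmodType K) : linear (fun _ : U => 0 : X).
Proof. by move=> c x y; rewrite scaler0 addr0. Qed.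

Lemma T3_map_zero (U X : s2mod K) t : T3_map (mk_linear (@zero_linear U X)) t = 0.
Proof.
move: t; apply: T3_ext; [exact: T3_map_linear | exact: zero_linear | move=> *].
by rewrite T3_map_tau (bilin0l _ (tau_bilinear _ _)).
Qed.

Section Components.
Variables V V' : s2mod K.
Let VV' := dsum_s2mod V V'.

Lemma dsum_fst_linear : linear (fun x : VV' => x.1).
Proof. by []. Qed.

Lemma dsum_snd_linear : linear (fun x : VV' => x.2).
Proof. by []. Qed.

End Components.

Section Projection.
Variables V V' W W' : s2mod K.
Let VV' := dsum_s2mod V V'.
Let WW' := dsum_s2mod W W'.

Definition diag_proj (x : tensor VV' WW') : (tensor V W * tensor V' W')%type :=
  (tens_map (mk_linear (@dsum_fst_linear V V')) (mk_linear (@dsum_fst_linear W W')) x,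
   tens_map (mk_linear (@dsum_snd_linear V V')) (mk_linear (@dsum_snd_linear W W')) x).

Lemma diag_proj_linear : linear diag_proj.
Proof. by move=> c x y; rewrite /diag_proj !linearP. Qed.

Definition diag_projL :
    {linear tens_s2mod VV' WW' -> dsum_s2mod (tens_s2mod V W) (tens_s2mod V' W')} :=
  mk_linear diag_proj_linear.

Lemma diag_projE (x : VV') (y : WW') : diag_projL (x ⊗ y) = (x.1 ⊗ y.1, x.2 ⊗ y.2).
Proof. by rewrite /= /diag_proj !tens_mapE. Qed.

Lemma diag_proj_ll v w :
  diag_projL (dsum_inl V V' v ⊗ dsum_inl W W' w) =
  dsum_inl (tens_s2mod V W) (tens_s2mod V' W') (v ⊗ w).
Proof. by rewrite diag_projE /= tens0l. Qed.

Lemma diag_proj_rr v w :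
  diag_projL (dsum_inr V V' v ⊗ dsum_inr W W' w) =
  dsum_inr (tens_s2mod V W) (tens_s2mod V' W') (v ⊗ w).
Proof. by rewrite diag_projE /= tens0l. Qed.

Lemma diag_proj_lr v w : diag_projL (dsum_inl V V' v ⊗ dsum_inr W W' w) = 0.
Proof. by rewrite diag_projE /= tens0l tens0r. Qed.

Lemma diag_proj_rl v w : diag_projL (dsum_inr V V' v ⊗ dsum_inl W W' w) = 0.
Proof. by rewrite diag_projE /= tens0l tens0r. Qed.

Definition diag_projD := (diag_proj_ll, diag_proj_rr, diag_proj_lr, diag_proj_rl).

Lemma diag_proj_swap x : diag_projL (swap x) = swap (diag_projL x).
Proof.
apply: (tens_lift_uniq (f := diag_projL \o swap) (g := swap \o diag_projL)) => u v.
by rewrite /= /diag_proj !tens_mapE.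
Qed.

Lemma diag_proj_gproj n x : diag_projL (gproj n x) = gproj n (diag_projL x).
Proof. by congr pair; apply: tens_map_gproj. Qed.

End Projection.

Section Hom.
Variables A A' B B' : boqd K.
Notation π := (diag_projL A A' B B').
Notation tau0l := (bilin0l _ (tau_bilinear _ _)).
Notation tau0r := (bilin0r _ (tau_bilinear _ _)).

(** Handles the products of two unmixed relations, by naturality of [psi]: h is
    an inclusion for the summands that are kept and zero for those killed. *)
Lemma T3_map_psi_comp (V W : s2mod K) (f : {linear V -> dsum_s2mod A A'})
    (g : {linear W -> dsum_s2mod B B'})
    (h : {linear tens_s2mod V W -> dsum_s2mod (tens_s2mod A B) (tens_s2mod A' B')}) r s :
  (forall n v, f (gproj n v) = gproj n (f v)) ->
  (forall n w, g (gproj n w) = gproj n (g w)) ->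
  (forall v w, π (f v ⊗ g w) = h (v ⊗ w)) ->
  T3_map π (psi (T3_map f r) (T3_map g s)) = T3_map h (psi r s).
Proof.
move=> fp gp fgh; rewrite -psi_map //; apply: T3_map_comp.
apply: (tens_lift_uniq (f := π \o (tens_map f g : {linear tens_s2mod V W -> _}))) => v w.
by rewrite -fgh /= tens_mapE.
Qed.

(** A monomial f(x) f(x') times the mixed relation of b and b' pairs b with one
    of f(x), f(x') and b' with the other, in both terms; so each term has a
    factor of the kind that the projection kills. *)
Lemma diag_proj_psi_mixr (V : s2mod K) (f : {linear V -> dsum_s2mod A A'})
    r i n q q' (b : B) (b' : B') :
  (forall n v, f (gproj n v) = gproj n (f v)) ->
  (forall v c, π (f v ⊗ dsum_inl B B' c) = 0) \/
    (forall v c, π (f v ⊗ dsum_inr B B' c) = 0) ->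
  homogeneous q b -> homogeneous q' b' ->
  T3_map π (psi (T3_map f r) (sym_tau i n (dsum_inl B B' b) (dsum_inr B B' b'))) = 0.
Proof.
move=> fp f0 bq bq'; move: r; apply: T3_ext => [c x y|c x y|j p p' a a' ap ap'].
- by rewrite T3_map_linear psi_linearl T3_map_linear.
- by rewrite scaler0 addr0.
rewrite T3_map_tau psiDr psiZr T3_mapD T3_mapZ.
rewrite (T3_map_psi_tau _ _ _ _ _ (homog_map fp ap') (homog_inl B' bq)).
rewrite (T3_map_psi_tau _ _ _ _ _ (homog_map fp ap') (homog_inr B bq')).
by case: ifP; case: f0 => f0; rewrite ?f0 ?tau0l ?tau0r !scaler0 ?addr0.
Qed.

Lemma diag_proj_psi_mixl (W : s2mod K) (g : {linear W -> dsum_s2mod B B'})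
    s i n p p' (a : A) (a' : A') :
  (forall n w, g (gproj n w) = gproj n (g w)) ->
  (forall c w, π (dsum_inl A A' c ⊗ g w) = 0) \/
    (forall c w, π (dsum_inr A A' c ⊗ g w) = 0) ->
  homogeneous p a -> homogeneous p' a' ->
  T3_map π (psi (sym_tau i n (dsum_inl A A' a) (dsum_inr A A' a')) (T3_map g s)) = 0.
Proof.
move=> gp g0 ap ap'; move: s; apply: T3_ext => [c x y|c x y|j q q' b b' bq bq'].
- by rewrite T3_map_linear psi_linearr T3_map_linear.
- by rewrite scaler0 addr0.
rewrite T3_map_tau psiDl psiZl T3_mapD T3_mapZ.
rewrite (T3_map_psi_tau _ _ _ _ _ (homog_inr A ap') (homog_map gp bq)).
rewrite (T3_map_psi_tau _ _ _ _ _ (homog_inl A' ap) (homog_map gp bq)).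
by case: ifP; case: g0 => g0; rewrite ?g0 ?tau0l ?tau0r !scaler0 ?addr0.
Qed.

(** Of the four products of terms, the two in which a meets b' and a' meets b
    vanish.  The last one has the sign |a||a'| + |b||b'| + |a||b'|, which is the
    sign of the mixed relation of a ⊗ b and a' ⊗ b' up to |a'||b|. *)
Lemma diag_proj_psi_mix_mix i j p p' q q' (a : A) (a' : A') (b : B) (b' : B') :
  homogeneous p a -> homogeneous p' a' -> homogeneous q b -> homogeneous q' b' ->
  T3_map π (psi (sym_tau i (p * p') (dsum_inl A A' a) (dsum_inr A A' a'))
                (sym_tau j (q * q') (dsum_inl B B' b) (dsum_inr B B' b'))) =
  if i == j then (-1) ^ (p' * q) *: sym_tau i ((p + q) * (p' + q'))
    (dsum_inl (tens_s2mod A B) (tens_s2mod A' B') (a ⊗ b))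
    (dsum_inr (tens_s2mod A B) (tens_s2mod A' B') (a' ⊗ b'))
  else 0.
Proof.
move=> ap ap' bq bq'; rewrite T3_map_psi_expand.
rewrite (T3_map_psi_tau _ _ _ _ _ (homog_inr A ap') (homog_inl B' bq)).
rewrite (T3_map_psi_tau _ _ _ _ _ (homog_inr A ap') (homog_inr B bq')).
rewrite (T3_map_psi_tau _ _ _ _ _ (homog_inl A' ap) (homog_inl B' bq)).
rewrite (T3_map_psi_tau _ _ _ _ _ (homog_inl A' ap) (homog_inr B bq')).
rewrite !diag_projD; case: ifP => _; last by rewrite !(scaler0, addr0).
rewrite !tau0l !scaler0 !addr0 add0r.
rewrite scalerDr !scalerA; congr (_ + _ *: _).
have n0 : (-1 : K) != 0 by rewrite oppr_eq0 oner_eq0.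
have -> : (p + q) * (p' + q') = p * p' + q * q' + p * q' + p' * q by ring.
by rewrite !expfzDr // [RHS]mulrC -[RHS]mulrA signM_self mulr1.
Qed.

Lemma same_parity_tens (a : A) (a' : A') (b : B) (b' : B') :
  same_parity a a' -> same_parity b b' ->
  @same_parity K (tens_s2mod A B) (tens_s2mod A' B') (a ⊗ b) (a' ⊗ b').
Proof.
case=> -[aE aE'] [] [bE bE']; [left|right|right|left];
  by split; rewrite /= tens_mapE ?aE ?bE ?aE' ?bE' -?scaleN1r ?tensZl ?tensZr
    ?scalerA ?mulrNN ?mulr1 ?scale1r.
Qed.

Lemma diag_proj_rels t :
  rels (black (circ A A') (circ B B')) t ->
  rels (circ (black A B) (black A' B')) (T3_map π t).
Proof.
(* R0 disposes of the products that the projection kills. *)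
have Rs := rels_sub (circ (black A B) (black A' B')); have R0 := sub_S3_0 Rs.
move: t; apply: (black_rels_ind Rs (@T3_map_linear K _ _ _)) => r s AAr.
have psi_r r0 : linear (fun s => T3_map π (psi r0 s)).
  by move=> c x y; rewrite psi_linearr T3_map_linear.
have psi_l s0 : linear (fun r => T3_map π (psi r s0)).
  by move=> c x y; rewrite psi_linearl T3_map_linear.
have il := @dsum_inl_gproj K; have ir := @dsum_inr_gproj K.
move: s; apply: (circ_rels_ind (f := fun s => T3_map π (psi r s)) Rs (psi_r r)).
- move=> s Bs; move: r AAr; apply: (circ_rels_ind (f := fun r => T3_map π (psi r _)) Rs (psi_l _)).
  + move=> r Ar; rewrite (T3_map_psi_comp _ _ (il _ _) (il _ _) (@diag_proj_ll _ _ _ _)).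
    by apply: circ_rels_inl; apply: black_rels_psi.
  + move=> i p p' a a' ap ap' _; rewrite (diag_proj_psi_mixl _ _ _ (il _ _) _ ap ap') //.
    by right=> c w; rewrite diag_proj_rl.
  + move=> r _; rewrite (T3_map_psi_comp _ _ (ir _ _) (il _ _) (h := mk_linear (@zero_linear _ _))).
      by rewrite T3_map_zero.
    exact: diag_proj_rl.
- move=> i q q' b b' bq bq' bb; move: r AAr.
  apply: (circ_rels_ind (f := fun r => T3_map π (psi r _)) Rs (psi_l _)).
  + move=> r _; rewrite (diag_proj_psi_mixr _ _ _ (il _ _) _ bq bq') //.
    by right=> v c; rewrite diag_proj_lr.
  + move=> j p p' a a' ap ap' aa; rewrite diag_proj_psi_mix_mix //.
    case: ifP => _ //; apply: sub_S3Z => //.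
    apply: (@circ_rels_mix K (black A B) (black A' B')); try exact: homog_tens.
    exact: same_parity_tens.
  + move=> r _; rewrite (diag_proj_psi_mixr _ _ _ (ir _ _) _ bq bq') //.
    by left=> v c; rewrite diag_proj_rl.
move=> s Bs; move: r AAr; apply: (circ_rels_ind (f := fun r => T3_map π (psi r _)) Rs (psi_l _)).
- move=> r _; rewrite (T3_map_psi_comp _ _ (il _ _) (ir _ _) (h := mk_linear (@zero_linear _ _))).
    by rewrite T3_map_zero.
  exact: diag_proj_lr.
- move=> i p p' a a' ap ap' _; rewrite (diag_proj_psi_mixl _ _ _ (ir _ _) _ ap ap') //.
  by left=> c w; rewrite diag_proj_lr.
move=> r Ar; rewrite (T3_map_psi_comp _ _ (ir _ _) (ir _ _) (@diag_proj_rr _ _ _ _)).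
by apply: circ_rels_inr; apply: black_rels_psi.
Qed.

Definition interchange :
    boqd_hom (black (circ A A') (circ B B')) (circ (black A B) (black A' B')) :=
  @BoqdHom K (black (circ A A') (circ B B')) (circ (black A B) (black A' B')) π
    (@diag_proj_gproj A A' B B') (@diag_proj_swap A A' B B') diag_proj_rels.

End Hom.

Section UnitMaps.

Let I := black_unit K.
Let O := circ_unit K.

Lemma diag_linear : linear (fun k : I => (k, k) : circ I I).
Proof. by []. Qed.

Definition diagL : {linear I -> circ I I} := mk_linear diag_linear.

(** In the image of the unit relation the two pure parts are the unit relations
    of the summands and the cross terms are mixed relations, as 1 is invariant
    of degree 0. *)
Lemma diagL_rels t : rels I t -> rels (circ I I) (T3_map diagL t).
Proof.
have Rs := rels_sub (circ I I).
move: t; apply: (black_unit_rels_ind Rs (@T3_map_linear K _ _ _)).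
pose u : T3 I := \sum_(i < 3) tau i (1 : K^o) (1 : K^o).
have Iu : rels I u by apply: span_gen.
pose m i := sym_tau i (0 * 0) (dsum_inl I I (1 : K^o)) (dsum_inr I I (1 : K^o)).
have mE i : rels (circ I I) (m i).
  by apply: (@circ_rels_mix K I I) => //; left.
have -> : T3_map diagL u =
    T3_map (dsum_inl I I) u + \sum_(i < 3) m i + T3_map (dsum_inr I I) u.
  rewrite /m /sym_tau mulr0 expr0z big_split -scaler_sumr scale1r.
  apply/ffunP => i; rewrite !ffunE !sum_tau !tens_mapE.
  by rewrite [diagL 1]dsum_decomp tensDl !tensDr !addrA.
apply: (sub_S3D Rs); last exact: circ_rels_inr.
apply: (sub_S3D Rs); first exact: circ_rels_inl.
apply: (big_ind (rels (circ I I))) => [|x y|i _]; last exact: mE.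
  exact: sub_S3_0.
exact: sub_S3D.
Qed.

Definition circ_diag : boqd_hom I (circ I I) :=
  @BoqdHom K I (circ I I) diagL (fun n k => erefl) (fun _ => erefl) diagL_rels.

Definition zeroL : {linear black O O -> O} := mk_linear (@zero_linear (black O O) O).

Lemma zeroL_rels t : rels (black O O) t -> rels O (T3_map zeroL t).
Proof. by move=> _; rewrite T3_map_zero; apply: sub_S3_0 (rels_sub _). Qed.

Definition circ_unit_zero : boqd_hom (black O O) O :=
  @BoqdHom K (black O O) O zeroL (fun n x => erefl) (fun x => erefl) zeroL_rels.

End UnitMaps.

End Interchange.

Theorem proposition4p1 (K : fieldType) (charK : 2%N \notin [pchar K]) :
  exists phi : forall A A' B B' : boqd K,
      boqd_hom (black (circ A A') (circ B B')) (circ (black A B) (black A' B')),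
  (forall (A A' B B' : boqd K) (a : A) (a' : A') (b : B) (b' : B'),
     phi A A' B B' ((a, a') ⊗ (b, b')) = (a ⊗ b, a' ⊗ b')) /\
  exists (Mb : monoidal (black_bifunctor K) (black_unit K))
         (Mc : monoidal (circ_bifunctor K) (circ_unit K)),
  [/\ forall (A B C : boqd K) (a : A) (b : B) (c : C),
        [/\ hom_map (assoc Mb A B C) ((a ⊗ b) ⊗ c) = a ⊗ (b ⊗ c),
            hom_map (lunit Mb A) ((1 : K^o) ⊗ a) = a &
            hom_map (runit Mb A) (a ⊗ (1 : K^o)) = a],
      forall (A B C : boqd K) (a : A) (b : B) (c : C),
        [/\ hom_map (assoc Mc A B C) ((a, b), c) = (a, (b, c)),
            hom_map (lunit Mc A) (0, a) = a &
            hom_map (runit Mc A) (a, 0) = a],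
      lax_2monoidal Mb Mc phi &
      colax_2monoidal Mc Mb phi].
Proof.
exists (@interchange K); split.
  by move=> A A' B B' a a' b b'; apply: diag_projE.
exists (black_monoidal K), (circ_monoidal K); split.
- move=> A B C a b c; split; first exact: tens_assocE.
    by rewrite /= tens_lunitE scale1r.
  by rewrite /= tens_runitE scale1r.
- by [].
- exists (circ_diag K); split.
  + move=> [A A'] [B B'] [C C'] [D D'] [f f'] [g g']; apply: black_hom_ext => -[a a'] [b b'].
    by rewrite /= /diag_proj /= !tens_mapE.
  + move=> [A A'] [B B'] [C C']; apply: black3_hom_ext => -[a a'] [b b'] [c c'].
    rewrite /= /diag_proj /= !tens_mapE /= ![tens_map _ _ ((a, a') ⊗ (b, b'))]tens_mapE.
    by rewrite /= !tensE /= /diag_proj !tens_mapE.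
  + move=> [A A']; apply: black_hom_ext => k [a a'].
    by rewrite /= /diag_proj /= !tensE.
  + move=> [A A']; apply: black_hom_ext => -[a a'] k.
    by rewrite /= /diag_proj /= !tensE.
exists (circ_unit_zero K); split.
+ move=> [A A'] [B B'] [C C'] [D D'] [f f'] [g g']; apply: black_hom_ext => -[a a'] [b b'].
  by rewrite /= /diag_proj /= !tens_mapE.
+ move=> [A A'] [B B'] [C C']; apply: black_hom_ext => -[[a b] c] [[a' b'] c'].
  by rewrite /= /diag_proj /= !tens_mapE.
+ move=> [A A']; apply: black_hom_ext => -[z a] [z' a'].
  by rewrite /= /diag_proj /= !tens_mapE.
+ move=> [A A']; apply: black_hom_ext => -[a z] [a' z'].
  by rewrite /= /diag_proj /= !tens_mapE.
Qed.
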